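(* Let $\Omega$ be a bounded measurable set in $\mathbb{R}^d$ of positive Lebesgue measure. Suppose there exists a measurable set $S\subset\mathbb{R}^d$ such that (i) $m(S)>0$; (ii) $m(S\cap\Omega)=0$; (iii) for every $x\in\mathbb{R}^d$, if $m((\Omega+x)\cap S)>0$ then $m((\Omega+x)\cap\Omega)>0$. Then $\Omega$ is not a spectral set.
   Context: $m$ denotes Lebesgue measure. $\Omega$ is spectral if there is a countable set $\Lambda\subset\mathbb{R}^d$ such that the exponentials $e^{2\pi i\langle\lambda,x\rangle}$, $\lambda\in\Lambda$, form an orthogonal basis of $L^2(\Omega)$. *)

(* Defs.v *)
(* Lebesgue measure on R^d (R^d = 'rV[R]_d) is built here as the usual
   Lebesgue outer measure (infimum over countable covers by half-open boxes of
   the sum of the box volumes), restricted to its Caratheodory-measurable sets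
   (= the Lebesgue measurable sets).  L^2(Omega) (complex valued) is handled
   through real and imaginary parts. *)
From HB Require Import structures.
From mathcomp Require Import all_boot all_order all_algebra.
From mathcomp Require Import all_classical all_reals all_analysis.

Set Implicit Arguments.
Unset Strict Implicit.
Unset Printing Implicit Defensive.

Import Order.TTheory GRing.Theory Num.Def Num.Theory.
Import numFieldTopology.Exports.

Local Open Scope classical_set_scope.
Local Open Scope ring_scope.

Section Lebesgue_Rd.
Context (R : realType) (d : nat).

Definition box (a b : 'rV[R]_d) : set 'rV[R]_d :=
  [set x | forall i : 'I_d, a ord0 i <= x ord0 i < b ord0 i].

Definition box_vol (a b : 'rV[R]_d) : R :=
  \prod_(i < d) maxr (b ord0 i - a ord0 i) 0.

Definition boxes : set (set 'rV[R]_d) := [set A | exists a b, A = box a b].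

(* volume of a box (and 0 on the empty set, +oo on non-boxes) *)
Definition box_premeasure (A : set 'rV[R]_d) : \bar R :=
  if `[< A = set0 >] then 0%E
  else ereal_inf [set (box_vol p.1 p.2)%:E
                 | p in [set p : 'rV[R]_d * 'rV[R]_d | A = box p.1 p.2]].

Lemma box_premeasure0 : box_premeasure set0 = 0%E.
Proof. by rewrite /box_premeasure asboolT. Qed.

Lemma box_premeasure_ge0 (A : set (g_sigma_algebraType boxes)) :
  (0 <= box_premeasure A)%E.
Proof.
rewrite /box_premeasure; case: ifPn => // _.
apply/ereal_infP => _ [p _ <-]; rewrite lee_fin.
by apply: prodr_ge0 => i _; rewrite le_max lexx orbT.
Qed.

Definition lebesgue_outer : set 'rV[R]_d -> \bar R :=
  mu_ext (box_premeasure : set (g_sigma_algebraType boxes) -> \bar R).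

HB.instance Definition _ := isOuterMeasure.Build R 'rV[R]_d lebesgue_outer
  (@mu_ext0 _ _ _ (box_premeasure : set (g_sigma_algebraType boxes) -> \bar R) box_premeasure0 box_premeasure_ge0)
  (mu_ext_ge0 box_premeasure_ge0)
  (le_mu_ext (box_premeasure : set (g_sigma_algebraType boxes) -> \bar R))
  (mu_ext_sigma_subadditive box_premeasure_ge0).

Definition LebRd := caratheodory_type lebesgue_outer.

Definition lebRd : set LebRd -> \bar R := lebesgue_outer.

HB.instance Definition _ := isMeasure.Build _ _ _ lebRd
  (@caratheodory_measure0 R _ lebesgue_outer)
  (@caratheodory_measure_ge0 R _ lebesgue_outer)
  (@caratheodory_measure_sigma_additive R _ lebesgue_outer).

Definition dotRd (u x : 'rV[R]_d) : R := \sum_(i < d) u ord0 i * x ord0 i.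

Definition translate (A : set 'rV[R]_d) (x : 'rV[R]_d) : set 'rV[R]_d :=
  [set y + x | y in A].

Definition bounded_Rd (A : set 'rV[R]_d) : Prop :=
  exists M : R, forall x, A x -> forall i : 'I_d, `|x ord0 i| <= M.

(* real and imaginary parts of e^{2 pi i <l, x>} *)
Definition ecos (l x : 'rV[R]_d) : R := cos (2 * pi * dotRd l x).
Definition esin (l x : 'rV[R]_d) : R := sin (2 * pi * dotRd l x).

Definition L2_on (A : set LebRd) (u : LebRd -> R) : Prop :=
  measurable_fun A u /\ (\int[lebRd]_(x in A) ((u x) ^+ 2)%:E < +oo)%E.

(* the exponentials e_l, l in L, form an orthogonal basis of L^2(A):
   - orthogonality: <e_l, e_m> = \int_A e^{2 pi i <l - m, x>} dx = 0 for l <> m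
   - completeness: if f = u + i v in L^2(A) satisfies
     <f, e_l> = \int_A (u + i v)(ecos l - i esin l) = 0 for all l in L,
     then f = 0 a.e. on A. *)
Definition exp_orthogonal_basis (A : set LebRd) (L : set 'rV[R]_d) : Prop :=
  (forall l m, L l -> L m -> l <> m ->
     (\int[lebRd]_(x in A) (ecos (l - m) x)%:E = 0)%E /\
     (\int[lebRd]_(x in A) (esin (l - m) x)%:E = 0)%E) /\
  (forall u v : LebRd -> R, L2_on A u -> L2_on A v ->
     (forall l, L l ->
        (\int[lebRd]_(x in A) (u x * ecos l x + v x * esin l x)%:E = 0)%E /\
        (\int[lebRd]_(x in A) (v x * ecos l x - u x * esin l x)%:E = 0)%E) ->
     {ae lebRd, forall x, A x -> u x = 0 /\ v x = 0}).

Definition spectral (A : set LebRd) : Prop :=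
  exists L : set 'rV[R]_d, countable L /\ exp_orthogonal_basis A L.

End Lebesgue_Rd.

(* Main.v *)
Require Import Defs.
From HB Require Import structures.
From mathcomp Require Import all_boot all_order all_algebra.
From mathcomp Require Import all_classical all_reals all_analysis.
From mathcomp Require Import measurable_realfun lra ring.
Set Implicit Arguments.
Unset Strict Implicit.
Unset Printing Implicit Defensive.
Import Order.TTheory GRing.Theory Num.Def Num.Theory.
Import numFieldTopology.Exports.
Local Open Scope classical_set_scope.
Local Open Scope ring_scope.

(* Let rho = |p|^2 for a trigonometric polynomial p with frequencies in the
   spectrum L of Omega.  Orthogonality makes the integral of rho over every
   translate of Omega the same number M, while completeness makes such p dense
   in L^2(Omega), so p can be chosen (after a translation) so that almost all of
   the mass M lies on a small piece A of Omega moved near the origin.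
   By Tonelli, integrating rho against the overlap functions
   x |-> m(Omega `&` (Omega - x)) and x |-> m(S `&` (Omega - x)) gives M m(Omega) and
   M m(S).  On A the first overlap is nearly m(Omega), so A already exhausts
   M m(Omega), and the second one is nearly 0.  Hypothesis (iii) says that the
   second overlap is positive only where the first one is; by compactness it is
   bounded by a small constant plus a multiple of the first one, so its integral
   against rho is small compared with M, contradicting m(S) > 0. *)

(** * Boxes and measurability *)

Section Measure_Rd.
Context (R : realType) (d : nat).
Implicit Types (a b x y z : 'rV[R]_d) (A B E : set 'rV[R]_d).

Local Notation BorelRd := (g_sigma_algebraType (@boxes R d)).
Local Notation mu := (@lebesgue_outer R d).

(** The mass of |p|^2 on Omega + z does not depend on z because a translation multiplies each
    coefficient by a unit complex number, while orthogonality leaves only products of terms with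
    equal frequencies. Completeness is given as triviality of the orthogonal complement, so density
    has to come from a projection argument, which rests on the completeness of L^2. Tonelli asks for
    joint measurability of (x, y) |-> 1_Omega(x + y); inside the overlaps Omega is therefore
    replaced by a Borel set [E] that contains it and exceeds it by a null set. The constants must be
    fixed before rho is known: the comparison of the two overlaps depends only on the sets, and the
    mass of rho on a fixed cube is at most C M with C independent of rho. The outcome is M m(S) <=
    (3/4) M m(S). *)

Definition set_coord a (i : 'I_d) (c : R) : 'rV[R]_d :=
  \row_j (if j == i then c else a ord0 j).

Lemma set_coordE a i c j :
  set_coord a i c ord0 j = if j == i then c else a ord0 j.
Proof. by rewrite /set_coord mxE. Qed.

Definition halfspace (i : 'I_d) (c : R) : set 'rV[R]_d :=
  [set x | x ord0 i < c].

Lemma box_halfspace a b i c :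
  box a b `&` halfspace i c = box a (set_coord b i (minr (b ord0 i) c)).
Proof.
apply/seteqP; split => x.
  move=> [bx /= xc] j; have /andP[h1 h2] := bx j.
  rewrite h1 set_coordE /=; have [->|_] := eqVneq j i; last exact: h2.
  rewrite lt_min xc andbT.
  by have /andP[] := bx i.
move=> bx; split => /=.
  move=> j; have := bx j; rewrite set_coordE; case: eqP => [->|//].
  by rewrite lt_min => /and3P[-> ->].
by have := bx i; rewrite set_coordE eqxx lt_min => /and3P[].
Qed.

Lemma box_halfspaceC a b i c :
  box a b `&` ~` halfspace i c = box (set_coord a i (maxr (a ord0 i) c)) b.
Proof.
apply/seteqP; split => x.
  move=> [bx /= /negP]; rewrite /halfspace /= -leNgt => xc j.
  have /andP[h1 h2] := bx j.
  rewrite h2 set_coordE andbT; case: eqP => [->|//]; rewrite ge_max xc andbT.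
  by have /andP[] := bx i.
move=> bx; split => /=.
  move=> j; have := bx j; rewrite set_coordE; case: eqP => [->|//].
  by rewrite ge_max => /andP[/andP[-> _] ->].
rewrite /halfspace /=; apply/negP; rewrite -leNgt.
by have := bx i; rewrite set_coordE eqxx ge_max => /andP[/andP[]].
Qed.

Lemma box_volD1 a b i : box_vol a b =
  maxr (b ord0 i - a ord0 i) 0 *
  \prod_(j < d | j != i) maxr (b ord0 j - a ord0 j) 0.
Proof. by rewrite /box_vol (bigD1 i). Qed.

(** The truncation at 0 in each factor makes the identity hold for every [c]: when the hyperplane
    misses the box, one piece has volume 0 and the other is the whole box. *)
Lemma box_vol_split a b i c :
  box_vol a (set_coord b i (minr (b ord0 i) c)) +
  box_vol (set_coord a i (maxr (a ord0 i) c)) b = box_vol a b.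
Proof.
rewrite !(box_volD1 _ _ i) !set_coordE eqxx.
under eq_bigr => j /negbTE ji do rewrite set_coordE ji.
under [X in _ + _ * X]eq_bigr => j /negbTE ji do rewrite set_coordE ji.
rewrite -mulrDl; congr (_ * _).
rewrite /maxr /minr; do ![case: ifPn]; rewrite -?leNgt; lra.
Qed.

Lemma box_premeasure_box a b :
  (box_premeasure (box a b) <= (box_vol a b)%:E)%E.
Proof.
rewrite /box_premeasure; case: ifPn => _.
  by rewrite lee_fin; apply: prodr_ge0 => i _; rewrite le_max lexx orbT.
by apply: ereal_inf_lbound => /=; exists (a, b).
Qed.

(** Non-boxes have premeasure +oo, so only box representations need testing; the empty set is set
    apart because its premeasure is 0 by convention. *)
Lemma le_box_premeasure A (u : \bar R) : (0 <= u)%E ->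
  (forall a b, A = box a b -> (u <= (box_vol a b)%:E)%E) ->
  A !=set0 -> (u <= box_premeasure A)%E.
Proof.
move=> u0 h /set0P A0; rewrite /box_premeasure asboolF; last exact/eqP.
by apply/le_ereal_inf_tmp => _ [[a b] /= Aab <-]; exact: h.
Qed.

Lemma box_premeasure_split A i c :
  (box_premeasure (A `&` halfspace i c) +
   box_premeasure (A `&` ~` halfspace i c) <= box_premeasure A)%E.
Proof.
have [->|/set0P A0] := eqVneq A set0.
  by rewrite !set0I box_premeasure0 adde0.
apply: le_box_premeasure => //.
  by rewrite adde_ge0// box_premeasure_ge0.
move=> a b ->; rewrite box_halfspace box_halfspaceC.
rewrite -(box_vol_split a b i c) EFinD.
by apply: leeD; exact: box_premeasure_box.
Qed.

Definition cube (r : R) : set 'rV[R]_d :=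
  box (const_mx (- r)) (const_mx r).

Lemma cubeP r x : cube r x <-> forall i, - r <= x ord0 i < r.
Proof. by split => h i; have := h i; rewrite !mxE. Qed.

Lemma bigcup_cube : \bigcup_n cube n.+1%:R = setT.
Proof.
apply/seteqP; split => // x _.
pose s := \sum_(i < d) `|x ord0 i|.
exists (Num.truncn s) => //; apply/cubeP => i.
have xs : `|x ord0 i| <= s by rewrite /s (bigD1 i)//= lerDl sumr_ge0.
have s0 : 0 <= s by exact: le_trans xs.
have /andP[_ sn] := Num.Theory.truncn_itv s0.
have := le_lt_trans xs sn; rewrite ltr_norml => /andP[/ltW -> ->]//.
Qed.

Lemma borel_box a b : measurable (box a b : set BorelRd).
Proof. by apply: sub_sigma_algebra; exists a, b. Qed.

Lemma borel_halfspace i c : measurable (halfspace i c : set BorelRd).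
Proof.
rewrite -[halfspace i c]setTI -bigcup_cube setI_bigcupl.
by apply: bigcup_measurable => n _; rewrite /cube box_halfspace; exact: borel_box.
Qed.

(** Cutting every member of a cover along the hyperplane yields covers of the two parts of [X] at no
    greater total cost. The covers in [mu_ext] consist of Borel sets, hence the need for
    [borel_halfspace]. *)
Lemma measurable_halfspace i c : measurable (halfspace i c : set (LebRd R d)).
Proof.
apply: le_caratheodory_measurable => /= X.
apply/le_ereal_inf_tmp => _ [B [mB XB] <-].
have mH := borel_halfspace i c.
apply: (@le_trans _ _ (\sum_(k <oo) box_premeasure (B k `&` halfspace i c) +
   \sum_(k <oo) box_premeasure (B k `&` ~` halfspace i c))%E).
  apply: leeD; apply: ereal_inf_lbound; eexists; try reflexivity; split.
  - by move=> k; exact: measurableI.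
  - by rewrite -setI_bigcupl; exact: setSI.
  - by move=> k; apply: measurableI => //; exact: measurableC.
  - by rewrite -setI_bigcupl; exact: setSI.
rewrite -nneseriesD; last 2 first.
- by move=> *; exact: box_premeasure_ge0.
- by move=> *; exact: box_premeasure_ge0.
apply: lee_nneseries => k _.
  by move=> _; rewrite adde_ge0// box_premeasure_ge0.
exact: box_premeasure_split.
Qed.

Lemma measurable_coord_halfspace dT (T : measurableType dT)
    (f : T -> R) : (forall c, measurable [set t | f t < c]) ->
  measurable_fun setT f.
Proof.
move=> h; apply: (measurability _ (RGenInftyO.measurableE R)).
move=> _ [_ [c ->] <-]; rewrite setTI.
by rewrite (_ : _ @^-1` _ = [set t | f t < c])//;
  apply/seteqP; split => t /=; rewrite in_itv.
Qed.

Lemma borel_coord i :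
  measurable_fun setT ((fun x => x ord0 i) : BorelRd -> R).
Proof. apply: measurable_coord_halfspace => c; exact: borel_halfspace. Qed.

Lemma measurable_coord i :
  measurable_fun setT ((fun x => x ord0 i) : LebRd R d -> R).
Proof. apply: measurable_coord_halfspace => c; exact: measurable_halfspace. Qed.

Lemma measurable_to_borel dT (T : measurableType dT) (f : T -> 'rV[R]_d) :
  (forall i, measurable_fun setT (fun t => f t ord0 i)) ->
  measurable_fun setT (f : T -> BorelRd).
Proof.
move=> mf; apply: (@measurability _ _ T BorelRd setT f (@boxes R d)) => //.
move=> _ [_ [a [b ->]] <-]; rewrite setTI.
rewrite (_ : _ @^-1` _ = \bigcap_(i in [set: 'I_d])
  ((fun t => f t ord0 i) @^-1` `[a ord0 i, b ord0 i[)).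
  apply: fin_bigcap_measurable => // i _.
  by rewrite -[X in measurable X]setTI; exact: mf.
apply/seteqP; split => t /=.
  by move=> h i _ /=; have := h i; rewrite in_itv/=.
by move=> h i; have := h i I; rewrite /= in_itv.
Qed.

Lemma borel_measurable A : measurable (A : set BorelRd) ->
  measurable (A : set (LebRd R d)).
Proof.
move=> mA; have /(_ measurableT A mA) := @measurable_to_borel _ (LebRd R d)
  (fun x => x) measurable_coord.
by rewrite setTI.
Qed.

End Measure_Rd.

(** * Translation invariance *)

Section Translation.
Context (R : realType) (d : nat).
Implicit Types (a b x y z : 'rV[R]_d) (A B E : set 'rV[R]_d).

Local Notation BorelRd := (g_sigma_algebraType (@boxes R d)).
Local Notation mu := (@lebesgue_outer R d).

Definition shiftset A z : set 'rV[R]_d := [set x | A (x + z)].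

Lemma shiftsetE A z : shiftset A z = translate A (- z).
Proof.
apply/seteqP; split => x /=.
  by move=> Axz; exists (x + z) => //; rewrite addrK.
by case=> y Ay <-; rewrite /shiftset /= subrK.
Qed.

Lemma translateE A z : translate A z = shiftset A (- z).
Proof. by rewrite shiftsetE opprK. Qed.

Lemma shiftset_shiftset A y z : shiftset (shiftset A y) z = shiftset A (y + z).
Proof.
by apply/seteqP; split => x; rewrite /shiftset /= -addrA (addrC z).
Qed.

Lemma shiftset0 A : shiftset A 0 = A.
Proof. by apply/seteqP; split => x; rewrite /shiftset /= addr0. Qed.

Lemma shift_box a b z : shiftset (box a b) z = box (a - z) (b - z).
Proof.
apply/seteqP; split => x h i; have := h i;
  by rewrite !mxE ?lerBlDr ?ltrBrDr.
Qed.

Lemma box_vol_shift a b z : box_vol (a - z) (b - z) = box_vol a b.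
Proof.
apply: eq_bigr => i _; congr (maxr _ _); rewrite !mxE; lra.
Qed.

Lemma borel_shift A z : measurable (A : set BorelRd) ->
  measurable (shiftset A z : set BorelRd).
Proof.
move=> mA.
have mz i : measurable_fun [set: BorelRd] (fun t : BorelRd => (t + z) ord0 i).
  rewrite (_ : (fun _ => _) = (fun t : BorelRd => t ord0 i + z ord0 i)).
    by apply: measurable_funD => //; exact: borel_coord.
  by apply/funext => x; rewrite mxE.
by have /(_ measurableT A mA) := measurable_to_borel mz; rewrite setTI.
Qed.

Lemma lebesgue_outer_shift_le A z : (mu (shiftset A z) <= mu A)%E.
Proof.
apply/le_ereal_inf_tmp => _ [B [mB AB] <-].
apply: (@le_trans _ _ (\sum_(k <oo) box_premeasure (shiftset (B k) z))%E).
  apply: ereal_inf_lbound; exists (fun k => shiftset (B k) z) => //; split.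
    by move=> k; exact: borel_shift.
  by move=> x /AB[k _ Bk]; exists k.
apply: lee_nneseries => k _; first by move=> _; exact: box_premeasure_ge0.
have [->|/set0P B0] := eqVneq (B k) set0.
  by rewrite (_ : shiftset set0 z = set0)// !box_premeasure0.
apply: le_box_premeasure => //; first exact: box_premeasure_ge0.
move=> a b ->; rewrite shift_box -(box_vol_shift a b z).
exact: box_premeasure_box.
Qed.

Lemma lebesgue_outer_shift A z : mu (shiftset A z) = mu A.
Proof.
apply/eqP; rewrite eq_le lebesgue_outer_shift_le /=.
have := lebesgue_outer_shift_le (shiftset A z) (- z).
by rewrite shiftset_shiftset subrr shiftset0.
Qed.

Lemma measurable_shift A z : measurable (A : set (LebRd R d)) ->
  measurable (shiftset A z : set (LebRd R d)).
Proof.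
move=> mA; apply: le_caratheodory_measurable => /= X.
(* Invariance moves the shift from [A] to the test set [X], where the criterion for [A] applies. *)
have h B : mu (X `&` shiftset B z) = mu (shiftset X (- z) `&` B).
  rewrite -(lebesgue_outer_shift (shiftset X (- z) `&` B) z); congr (mu _).
  by apply/seteqP; split => x /=; rewrite /shiftset /= addrK.
have -> : ~` shiftset A z = shiftset (~` A) z by [].
by rewrite !h -(lebesgue_outer_shift X (- z)) -(mA (shiftset X (- z))).
Qed.

Lemma lebesgue_outer_le_premeasure A : measurable (A : set BorelRd) ->
  (mu A <= box_premeasure A)%E.
Proof.
move=> mA; apply: (@le_trans _ _
  (\sum_(k <oo) box_premeasure (if k is 0%N then A else set0))%E).
  apply: ereal_inf_lbound; eexists; last reflexivity; split.
    by case=> [|k]; [exact: mA|exact: measurable0].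
  by move=> x abx; exists 0%N.
rewrite (nneseries_split 0 1); last by move=> k _; exact: box_premeasure_ge0.
rewrite /= big_nat1 eseries0 ?adde0//.
by case=> // k _ _; exact: box_premeasure0.
Qed.

Lemma lebesgue_outer_box a b : (mu (box a b) <= (box_vol a b)%:E)%E.
Proof.
apply: le_trans (box_premeasure_box a b).
by apply: lebesgue_outer_le_premeasure; exact: borel_box.
Qed.

Lemma measurable_box a b : measurable (box a b : set (LebRd R d)).
Proof. by apply: borel_measurable; exact: borel_box. Qed.

Lemma lebesgue_outer_cube r : (mu (cube r) < +oo)%E.
Proof. exact: le_lt_trans (lebesgue_outer_box _ _) (ltry _). Qed.

Lemma lebRd_sigma_finite : sigma_finite [set: LebRd R d] (@lebRd R d).
Proof.
exists (fun n => cube n.+1%:R); first by rewrite bigcup_cube.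
move=> n; split; [exact: measurable_box|exact: lebesgue_outer_cube].
Qed.

HB.instance Definition _ := @Measure_isSigmaFinite.Build _ _ _ (@lebRd R d)
  lebRd_sigma_finite.

End Translation.

(** * Borel hulls and continuity of translations *)

Section Approximation.
Context (R : realType) (d : nat).
Implicit Types (a b x y z : 'rV[R]_d) (A B E : set 'rV[R]_d).

Local Notation BorelRd := (g_sigma_algebraType (@boxes R d)).
Local Notation mu := (@lebesgue_outer R d).

Lemma borel_cover A (e : R) : (mu A < +oo)%E -> 0 < e ->
  exists2 B : (set 'rV[R]_d)^nat,
    (forall k, measurable (B k : set BorelRd)) /\ A `<=` \bigcup_k B k &
    (\sum_(k <oo) box_premeasure (B k) <= mu A + e%:E)%E.
Proof.
move=> Afin e0.
have Afn : mu A \is a fin_num.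
  by rewrite ge0_fin_numE//; exact: outer_measure_ge0.
have [_ [B [mB AB] <-] Be] := lb_ereal_inf_adherent e0 Afn.
by exists B => //; exact: ltW.
Qed.

Lemma lebesgue_outer_cover (B : (set 'rV[R]_d)^nat) :
  (forall k, measurable (B k : set BorelRd)) ->
  (mu (\bigcup_k B k) <= \sum_(k <oo) box_premeasure (B k))%E.
Proof.
move=> mB; apply: le_trans (outer_measure_sigma_subadditive mu B) _.
apply: lee_nneseries => k _.
  by move=> _; exact: outer_measure_ge0.
exact: lebesgue_outer_le_premeasure.
Qed.

Lemma lebesgue_outerD A E : measurable (A : set (LebRd R d)) ->
  measurable (E : set (LebRd R d)) -> A `<=` E -> (mu E < +oo)%E ->
  mu (E `\` A) = (mu E - mu A)%E.
Proof.
move=> mA mE AE Efin.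
by have := @measureD _ _ _ (@lebRd R d) E A mE mA Efin; rewrite (setIidr AE).
Qed.

(** [E] is the intersection over n of Borel covers whose cost exceeds the measure of [A] by at most
    1 / (n + 1), cut down to the cube to stay bounded. *)
Lemma borel_hull A K : measurable (A : set (LebRd R d)) ->
  A `<=` cube K -> exists E, [/\ measurable (E : set BorelRd),
    A `<=` E, E `<=` cube K & mu (E `\` A) = 0%E].
Proof.
move=> mA AK.
have Afin : (mu A < +oo)%E.
  by apply: (le_lt_trans (le_outer_measure mu _ _ AK)); exact: lebesgue_outer_cube.
have h n : {B : (set 'rV[R]_d)^nat |
    ((forall k, measurable (B k : set BorelRd)) /\ A `<=` \bigcup_k B k) /\
    (\sum_(k <oo) box_premeasure (B k) <= mu A + (n.+1%:R^-1)%:E)%E}.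
  apply: cid; have [|B hB hB'] := @borel_cover A n.+1%:R^-1 Afin.
    by rewrite invr_gt0 ltr0n.
  by exists B.
pose B n := sval (h n).
have hB n : (forall k, measurable (B n k : set BorelRd)) /\
  A `<=` \bigcup_k B n k by have [] := proj1 (svalP (h n)).
have sB n : (\sum_(k <oo) box_premeasure (B n k) <= mu A + (n.+1%:R^-1)%:E)%E.
  by have [] := svalP (h n).
pose E := cube K `&` \bigcap_n \bigcup_k B n k.
have bE : measurable (E : set BorelRd).
  apply: measurableI; first exact: borel_box.
  apply: bigcapT_measurable => n; apply: bigcupT_measurable => k.
  by have [] := hB n.
have AE : A `<=` E.
  by move=> x Ax; split; [exact: AK|move=> n _; have [_] := hB n; exact].
have mE := borel_measurable bE.
exists E; split => //.
  by move=> x [].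
have muEA : (mu E <= mu A)%E.
  apply/lee_addgt0Pr => e e0.
  pose n := Num.truncn e^-1.
  apply: (@le_trans _ _ (mu A + (n.+1%:R^-1)%:E)%E).
    apply: le_trans (sB n); apply: le_trans (lebesgue_outer_cover (hB n).1).
    by apply: le_outer_measure => x [_]; exact.
  apply: leeD => //; rewrite lee_fin -[leRHS]invrK lef_pV2 ?posrE ?invr_gt0//.
  have ei0 : 0 <= e^-1 by rewrite invr_ge0 ltW.
  by have /andP[_ /ltW] := Num.Theory.truncn_itv ei0.
rewrite lebesgue_outerD//; last exact: le_lt_trans muEA Afin.
have -> : mu E = mu A.
  by apply/eqP; rewrite eq_le muEA /=; exact: le_outer_measure.
by rewrite subee// ge0_fin_numE//; exact: outer_measure_ge0.
Qed.

(** Continuity of translations at 0. One difference is enough: the other one, [shiftset A z] minus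
    [A], is a translate of the same expression at - z. *)
Definition shift_continuous A := forall e : R, 0 < e -> exists2 t : R, 0 < t &
  forall z, (forall i, `|z ord0 i| < t) -> (mu (A `\` shiftset A z) <= e%:E)%E.

Lemma shift_continuous0 : shift_continuous set0.
Proof.
by move=> e e0; exists 1 => // z _; rewrite set0D outer_measure0 lee_fin ltW.
Qed.

Lemma shift_continuousU A B : shift_continuous A -> shift_continuous B ->
  shift_continuous (A `|` B).
Proof.
move=> cA cB e e0.
have e2 : 0 < e / 2 by rewrite divr_gt0.
have [s s0 hs] := cA _ e2; have [t t0 ht] := cB _ e2.
exists (minr s t); first by rewrite lt_min s0.
move=> z hz; apply: (@le_trans _ _ (mu ((A `\` shiftset A z) `|` (B `\` shiftset B z)))).
  apply: le_outer_measure => x [[Ax|Bx] h].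
    by left; split => // h'; apply: h; left.
  by right; split => // h'; apply: h; right.
apply: le_trans (outer_measureU2 _ _ _) _.
rewrite [e]splitr EFinD; apply: leeD.
  by apply: hs => i; have := hz i; rewrite lt_min => /andP[].
by apply: ht => i; have := hz i; rewrite lt_min => /andP[].
Qed.

Lemma shift_continuous_box a b : shift_continuous (box a b).
Proof.
pose C i := \prod_(j < d | j != i) maxr (b ord0 j - a ord0 j) 0.
have C0 i : 0 <= C i by apply: prodr_ge0 => j _; rewrite le_max lexx orbT.
pose S := 2 * \sum_(i < d) C i.
have S0 : 0 <= S by rewrite mulr_ge0// sumr_ge0.
have S1 : 0 < S + 1 by rewrite ltr_pwDr.
move=> e e0; pose t := e / (S + 1); have t0 : 0 < t by rewrite divr_gt0.
exists t => // z hz.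
(* A point that leaves the box under a shift smaller than [t] lies within [t] of a face orthogonal
   to some axis i; [F i] consists of the two slabs along these faces. *)
pose F i := (box a b `&` halfspace i (a ord0 i + t)) `|`
            (box a b `&` ~` halfspace i (b ord0 i - t)).
apply: (@le_trans _ _ (mu (\big[setU/set0]_(i < d) F i))).
  apply: le_outer_measure => x [abx /existsNP[i hi]].
  rewrite (bigD1 i)//=; left.
  have /andP[h1 h2] := abx i.
  have := hz i; rewrite ltr_norml => /andP[z1 z2].
  move/negP: hi; rewrite mxE negb_and -ltNge -leNgt => /orP[h|h].
    by left; split => //; rewrite /halfspace /=; lra.
  by right; split => //; rewrite /halfspace /=; apply/negP; rewrite -leNgt; lra.
apply: (@le_trans _ _ (\sum_(i < d) (2 * t * C i)%:E)%E).
  apply: (big_ind2 (fun A v => (mu A <= v)%E)).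
  - by rewrite outer_measure0.
  - move=> A1 v1 A2 v2 h1 h2; apply: le_trans (outer_measureU2 _ _ _) _.
    exact: leeD.
  - move=> i _; apply: le_trans (outer_measureU2 _ _ _) _.
    rewrite box_halfspace box_halfspaceC.
    rewrite (_ : 2 * t * C i = t * C i + t * C i); last by ring.
    rewrite EFinD; apply: leeD; apply: le_trans (lebesgue_outer_box _ _) _;
      rewrite lee_fin (box_volD1 _ _ i) !set_coordE eqxx.
    + under eq_bigr => j /negbTE ji do rewrite set_coordE ji.
      apply: ler_wpM2r; first exact: C0.
      rewrite ge_max (ltW t0) andbT lerBlDl ge_min; apply/orP; right; lra.
    + under eq_bigr => j /negbTE ji do rewrite set_coordE ji.
      apply: ler_wpM2r; first exact: C0.
      rewrite ge_max (ltW t0) andbT lerBlDl -lerBlDr le_max.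
      by apply/orP; right; lra.
rewrite sumEFin lee_fin -mulr_sumr.
have -> : 2 * t * \sum_(i < d) C i = t * S by rewrite /S; ring.
rewrite /t mulrAC ler_pdivrMr// ler_wpM2l//; first exact: ltW.
lra.
Qed.

(** A cover of finite cost consists of boxes and empty sets, anything else costing +oo. Finitely
    many of its members form a set [O] that differs from [A] by at most e / 3 on either side. *)
Lemma shift_continuous_measurable A : measurable (A : set (LebRd R d)) ->
  (mu A < +oo)%E -> shift_continuous A.
Proof.
move=> mA Afin e e0.
have e3 : 0 < e / 3 by rewrite divr_gt0.
have [B [mB AB] sB] := borel_cover Afin e3.
have sBfin : (\sum_(k <oo) box_premeasure (B k) < +oo)%E.
  by apply: le_lt_trans sB _; rewrite lte_add_pinfty// ltry.
have [N hN] : exists N, (\sum_(N <= k <oo) box_premeasure (B k) <= (e / 3)%:E)%E.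
  have := nneseries_tail_cvg sBfin (fun k _ => box_premeasure_ge0 (B k)).
  move/fine_cvgP => [fin cv].
  have /cvgrPdist_le/(_ _ e3)[M _ hM] := cv.
  have [M' _ hM'] := fin.
  pose N := maxn M M'; exists N.
  have := hM N (leq_maxl _ _); rewrite /= sub0r normrN => h.
  rewrite -(fineK (hM' N (leq_maxr _ _))) lee_fin.
  exact: le_trans (ler_norm _) h.
pose O := \big[setU/set0]_(k < N) B k.
have mO : measurable (O : set (LebRd R d)).
  by apply: bigsetU_measurable => k _; exact/borel_measurable.
have mU : measurable (\bigcup_k B k : set (LebRd R d)).
  by apply: bigcupT_measurable => k; exact/borel_measurable.
have BO : shift_continuous O.
  rewrite /O; apply: (big_ind shift_continuous).
  - exact: shift_continuous0.
  - exact: shift_continuousU.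
  - move=> k _.
    have [->|/set0P B0] := eqVneq (B k) set0; first exact: shift_continuous0.
    have [[a [b ->]]|nbox] := pselect (exists a b, B k = box a b).
      exact: shift_continuous_box.
    exfalso; move: sBfin; rewrite ltNge => /negP; apply.
    rewrite (eseries_pinfty (k := nat_of_ord k)) //.
      by move=> n _; rewrite gt_eqF// (lt_le_trans _ (box_premeasure_ge0 _)).
    apply/eqP; rewrite -leye_eq; apply: le_box_premeasure => //.
    by move=> a b Bab; exfalso; apply: nbox; exists a, b.
have AO : (mu (A `\` O) <= (e / 3)%:E)%E.
  apply: le_trans hN.
  apply: le_trans (_ : mu (\bigcup_(k in ~` `I_N) B k) <= _)%E.
    apply: le_outer_measure => x [/AB[k _ Bk] nO]; exists k => //= kN.
    by apply: nO; rewrite /O -bigcup_mkord; exists k.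
  apply: le_trans (outer_measure_sigma_subadditive_tail _ _ _) _.
  apply: lee_nneseries => k _; first by move=> _; exact: outer_measure_ge0.
  exact: lebesgue_outer_le_premeasure.
have OA : (mu (O `\` A) <= (e / 3)%:E)%E.
  apply: (@le_trans _ _ (mu (\bigcup_k B k `\` A))).
    apply: le_outer_measure; apply: setSD => x.
    by rewrite /O -bigcup_mkord => -[k _ Bk]; exists k.
  rewrite lebesgue_outerD//; last first.
    exact: le_lt_trans (lebesgue_outer_cover mB) sBfin.
  have Afn : mu A \is a fin_num.
    by rewrite ge0_fin_numE//; exact: outer_measure_ge0.
  rewrite leeBlDl//; exact: le_trans (lebesgue_outer_cover mB) sB.
have [t t0 ht] := BO _ e3; exists t => // z /ht hz.
(* A point of [A] sent out of [A] is outside [O], or leaves [O], or lands in [O] outside [A]. *)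
apply: (@le_trans _ _ (mu ((A `\` O) `|` ((O `\` shiftset O z) `|`
  shiftset (O `\` A) z)))).
  apply: le_outer_measure => x [Ax nAx].
  have [Ox|] := pselect (O x); last by left.
  by right; have [Oz|] := pselect (O (x + z)); [right|left].
apply: le_trans (outer_measureU2 _ _ _) _.
rewrite (_ : e = e / 3 + (e / 3 + e / 3)); last by field.
rewrite !EFinD; apply: leeD => //.
apply: le_trans (outer_measureU2 _ _ _) _.
by apply: leeD => //; apply: le_trans (lebesgue_outer_shift_le _ _) OA.
Qed.

End Approximation.

(** * Completeness of L^2 and orthogonal projection *)

Section Riesz_Fischer.
Context (R : realType) dT (T : measurableType dT)
  (mu : {measure set T -> \bar R}) (D : set T).
Hypotheses (mD : measurable D) (Dfin : (mu D < +oo)%E).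
Implicit Types f g : T -> R.

Definition square_integrable f := measurable_fun D f /\
  (\int[mu]_(x in D) ((f x) ^+ 2)%:E < +oo)%E.

Lemma measurable_sqr f : measurable_fun D f ->
  measurable_fun D (fun x => ((f x) ^+ 2)%:E).
Proof. by move=> mf; apply/measurable_EFinP; exact: measurable_funX. Qed.

Lemma square_integrableD f g c : square_integrable f -> square_integrable g ->
  square_integrable (fun x => f x + c * g x).
Proof.
move=> [mf If] [mg Ig].
have mh : measurable_fun D (fun x => f x + c * g x).
  by apply: measurable_funD => //; apply: measurable_funM.
split => //.
have m1 := measurable_sqr mf; have m2 := measurable_sqr mg.
apply: (@le_lt_trans _ _ (\int[mu]_(x in D)
   (2%:E * (f x ^+ 2)%:E + (2 * c ^+ 2)%:E * (g x ^+ 2)%:E))%E).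
  apply: ge0_le_integral => //.
  - by move=> x _; rewrite lee_fin sqr_ge0.
  - exact: measurable_sqr.
  - by apply: emeasurable_funD; apply: emeasurable_funM.
  - move=> x _; rewrite -!EFinM -EFinD lee_fin.
    have := sqr_ge0 (f x - c * g x); nra.
rewrite ge0_integralD//.
all: try by apply: emeasurable_funM.
all: try by move=> *; rewrite -EFinM lee_fin; do ![exact: sqr_ge0|apply: mulr_ge0].
rewrite !ge0_integralZl//.
all: try by move=> *; rewrite lee_fin; do ![exact: sqr_ge0|apply: mulr_ge0].
apply: lte_add_pinfty; apply: lte_mul_pinfty => //.
by rewrite lee_fin; apply: mulr_ge0 => //; exact: sqr_ge0.
Qed.

Lemma square_integrableM f g : square_integrable f -> square_integrable g ->
  mu.-integrable D (fun x => (f x * g x)%:E).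
Proof.
move=> [mf If] [mg Ig]; apply/integrableP; split.
  by apply/measurable_EFinP; exact: measurable_funM.
have m1 := measurable_sqr mf; have m2 := measurable_sqr mg.
apply: (@le_lt_trans _ _ (\int[mu]_(x in D)
   ((f x ^+ 2)%:E + (g x ^+ 2)%:E))%E).
  apply: ge0_le_integral => //.
  - apply: measurableT_comp => //.
    by apply/measurable_EFinP; exact: measurable_funM.
  - exact: emeasurable_funD.
  - move=> x _; rewrite /= lee_fin ler_norml.
    have := sqr_ge0 (f x - g x); have := sqr_ge0 (f x + g x); nra.
rewrite ge0_integralD//; last first.
- by move=> x _; rewrite lee_fin sqr_ge0.
- by move=> x _; rewrite lee_fin sqr_ge0.
exact: lte_add_pinfty.
Qed.

Lemma limn_einf_le (u : (\bar R)^nat) (c : \bar R) :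
  (forall n, (u n <= c)%E) -> (limn_einf u <= c)%E.
Proof.
move=> uc; rewrite limn_einf_lim; apply: lime_le.
  exact: is_cvg_einfs.
apply: nearW => n; apply: le_trans (uc n).
by apply: ereal_inf_lbound; exists n => /=.
Qed.

(** The pointwise bound |a| <= q + a^2 / q with q = 2^-k turns the L^2 rate into a summable L^1
    rate, [D] being of finite measure. *)
Lemma integrable_increments (f : (T -> R)^nat) :
  (forall n, square_integrable (f n)) ->
  (forall n, (\int[mu]_(x in D) ((f n.+1 x - f n x) ^+ 2)%:E <=
     (2^-1 ^+ n ^+ 2)%:E)%E) ->
  (\int[mu]_(x in D) \sum_(k <oo) (`|f k.+1 x - f k x|)%:E < +oo)%E.
Proof.
move=> sf hf.
have mf n : measurable_fun D (f n) by case: (sf n).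
have md k : measurable_fun D (fun x => f k.+1 x - f k x).
  exact: measurable_funB.
rewrite integral_nneseries//; last first.
  by move=> k; apply/measurable_EFinP; exact: measurableT_comp.
have Dfn : mu D \is a fin_num by rewrite ge0_fin_numE.
pose r : R := 2 * (fine (mu D) + 1).
apply: (@le_lt_trans _ _ (\sum_(k <oo) (r / (2 ^ (k + 1))%:R)%:E)%E); last first.
  by rewrite (cvg_lim _ (@cvg_geometric_eseries_half R r 0))// ltry.
apply: lee_nneseries => k _.
  by move=> _; apply: integral_ge0 => x _; rewrite lee_fin.
pose q : R := 2^-1 ^+ k.
have q0 : 0 < q by rewrite exprn_gt0// invr_gt0.
apply: (@le_trans _ _ (\int[mu]_(x in D)
   (q%:E + (q^-1)%:E * ((f k.+1 x - f k x) ^+ 2)%:E))%E).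
  apply: ge0_le_integral => //.
  - by apply/measurable_EFinP; exact: measurableT_comp.
  - apply: emeasurable_funD => //; apply: emeasurable_funM => //.
    exact: measurable_sqr.
  - move=> x _; rewrite -EFinM -EFinD lee_fin -[X in _ <= _ + _ * X]real_normK ?num_real//.
    set a := `| _ |.
    have -> : q + q^-1 * a ^+ 2 = a + q^-1 * ((a - q) ^+ 2 + a * q).
      by field; rewrite gt_eqF.
    rewrite lerDl; apply: mulr_ge0; first by rewrite invr_ge0 ltW.
    apply: addr_ge0; first exact: sqr_ge0.
    by apply: mulr_ge0; [exact: normr_ge0|exact: ltW].
rewrite ge0_integralD//; last first.
- by apply: emeasurable_funM => //; exact: measurable_sqr.
- by move=> x _; rewrite -EFinM lee_fin mulr_ge0 ?sqr_ge0// invr_ge0 ltW.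
- by move=> x _; rewrite lee_fin ltW.
rewrite ge0_integralZl//.
all: try by move=> *; rewrite lee_fin ?sqr_ge0// invr_ge0 ltW.
all: try exact: measurable_sqr.
rewrite integral_cst//.
apply: (@le_trans _ _ (q%:E * mu D + (q^-1)%:E * (q ^+ 2)%:E)%E).
  by apply: leeD => //; apply: lee_wpmul2l => //; rewrite lee_fin invr_ge0 ltW.
rewrite -(fineK Dfn) -!EFinM -EFinD lee_fin addn1 expnS natrM natrX.
rewrite /r le_eqVlt; apply/orP; left; apply/eqP.
rewrite /q exprVn; field.
by rewrite expf_neq0.
Qed.

(** The increments are summable in L^1, hence absolutely summable almost everywhere, which gives a
    pointwise limit; the L^2 bound passes to it by Fatou. *)
Lemma riesz_fischer (f : (T -> R)^nat) :
  (forall n, square_integrable (f n)) ->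
  (forall n m, (n <= m)%N -> (\int[mu]_(x in D) ((f m x - f n x) ^+ 2)%:E <=
     (2^-1 ^+ n ^+ 2)%:E)%E) ->
  exists2 g, square_integrable g & forall n,
    (\int[mu]_(x in D) ((g x - f n x) ^+ 2)%:E <= (2^-1 ^+ n ^+ 2)%:E)%E.
Proof.
move=> sf hf.
have mf n : measurable_fun D (f n) by case: (sf n).
pose h x := (\sum_(k <oo) (`|f k.+1 x - f k x|)%:E)%E.
have mh : measurable_fun D h.
  apply: ge0_emeasurable_sum => [k x _ _|k _]; first by rewrite lee_fin.
  apply/measurable_EFinP; apply: measurableT_comp => //.
  exact: measurable_funB.
have h0 x : (0 <= h x)%E by apply: nneseries_ge0 => k _ _; rewrite lee_fin.
have Ih : mu.-integrable D h.
  apply/integrableP; split => //.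
  under eq_integral do rewrite gee0_abs//.
  by apply: integrable_increments => // n; exact: hf.
have [N [mN N0 DN]] := integrable_ae mD Ih.
pose D' := D `\` N.
have mD' : measurable D' by exact: measurableD.
have cvf x : D' x -> cvgn (f ^~ x).
  move=> [Dx Nx].
  have hx : h x \is a fin_num.
    by apply: contrapT => hx; apply: Nx; apply: DN => /(_ Dx).
  have : cvgn (series (fun k => `|f k.+1 x - f k x|)).
    apply: nondecreasing_is_cvgn; first exact: nondecreasing_series.
    exists (fine (h x)) => _ [n _ <-]; rewrite -lee_fin fineK// /series /=.
    rewrite -sumEFin; apply: nneseries_lim_ge => k _ _.
    by rewrite lee_fin.
  move=> cs0; have cs : cvgn (series (telescope (f ^~ x))).
    exact: (@normed_cvg _ R^o).
  rewrite (_ : f ^~ x = (fun n => f 0%N x + series (telescope (f ^~ x)) n)).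
    by apply: is_cvgD => //; exact: is_cvg_cst.
  by apply/funext => n; rewrite -(eq_sum_telescope (f ^~ x)).
(* The indicator forces convergence everywhere, so that the limit is measurable. *)
pose ft n x := f n x * \1_D' x.
pose g x := limn (ft ^~ x).
have cvft x : ft n x @[n --> \oo] --> g x.
  rewrite /g; have [D'x|D'x] := pselect (D' x).
    rewrite (_ : ft ^~ x = f ^~ x); first exact: cvf.
    by apply/funext => n; rewrite /ft indicE mem_set// mulr1.
  rewrite (_ : ft ^~ x = cst 0).
    exact: is_cvg_cst.
  by apply/funext => n; rewrite /ft indicE memNset// mulr0.
have mg : measurable_fun D g.
  apply: (measurable_fun_cvg (h := ft)) => [n|x _]; last exact: cvft.
  by apply: measurable_funM => //; exact: measurable_indic.
have bnd n : (\int[mu]_(x in D) ((g x - f n x) ^+ 2)%:E <= (2^-1 ^+ n ^+ 2)%:E)%E.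
  have mgf : measurable_fun D (fun x => ((g x - f n x) ^+ 2)%:E).
    by apply: measurable_sqr; exact: measurable_funB.
  rewrite (ge0_negligible_integral mN)//; last first.
    by move=> x _; rewrite lee_fin sqr_ge0.
  pose F m x := ((f (m + n)%N x - f n x) ^+ 2)%:E.
  have D'D : D' `<=` D by move=> x [].
  have mF m : measurable_fun D (F m).
    by apply: measurable_sqr; exact: measurable_funB.
  have eqF : (\int[mu]_(x in D') ((g x - f n x) ^+ 2)%:E =
    \int[mu]_(x in D') limn_einf (F ^~ x))%E.
    apply: eq_integral => x /[!inE] D'x.
    suff /cvg_limn_einf_sup[->] : F m x @[m --> \oo] --> ((g x - f n x) ^+ 2)%:E.
      by [].
    apply: cvg_EFin; first exact: nearW.
    have : f m x @[m --> \oo] --> g x.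
      have := cvft x; rewrite (_ : ft ^~ x = f ^~ x)//.
      by apply/funext => m; rewrite /ft indicE mem_set// mulr1.
    rewrite -(cvg_shiftn n) => cv.
    have cB : f (m + n)%N x - f n x @[m --> \oo] --> g x - f n x.
      by apply: cvgB => //; exact: cvg_cst.
    by rewrite !expr2; apply: cvgM.
  rewrite [leLHS]eqF; apply: le_trans (fatou _ _ _ _) _ => //.
  - by move=> m; exact: measurable_funS (mF m).
  - by move=> m x _; rewrite lee_fin sqr_ge0.
  - apply: limn_einf_le => m.
    apply: (@le_trans _ _ (\int[mu]_(x in D) F m x)%E); last first.
      exact: (hf n (m + n)%N (leq_addl _ _)).
    apply: (ge0_subset_integral mu mD' mD (mF m) _ D'D).
    by move=> x _; rewrite lee_fin sqr_ge0.
exists g => //.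
have sgf : square_integrable (fun x => g x - f 0%N x).
  split; first exact: measurable_funB.
  exact: le_lt_trans (bnd 0%N) (ltry _).
have := square_integrableD 1 sgf (sf 0%N).
by rewrite (_ : (fun _ => _) = g)//; apply/funext => x; rewrite mul1r subrK.
Qed.

End Riesz_Fischer.

(** * Orthogonal projection for complex functions written as real pairs *)

Section Projection.
Context (R : realType) dT (T : measurableType dT)
  (mu : {measure set T -> \bar R}) (D : set T).
Hypotheses (mD : measurable D) (Dfin : (mu D < +oo)%E).
Local Notation V := ((T -> R) * (T -> R))%type.
Implicit Types (F G H : V) (W : set V).
Local Notation L2 := (square_integrable mu D).

Definition pcomb F (c : R) G : V :=
  (fun x => F.1 x + c * G.1 x, fun x => F.2 x + c * G.2 x).

Definition L2pair F := L2 F.1 /\ L2 F.2.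

(** Real part of the Hermitian inner product of F.1 + i F.2 and G.1 + i G.2. *)
Definition ip F G : R := \int[mu]_(x in D) (F.1 x * G.1 x + F.2 x * G.2 x).

Lemma L2pair_comb F c G : L2pair F -> L2pair G -> L2pair (pcomb F c G).
Proof. by move=> [? ?] [? ?]; split; exact: square_integrableD. Qed.

Lemma ip_integrable F G : L2pair F -> L2pair G ->
  mu.-integrable D (EFin \o (fun x => F.1 x * G.1 x + F.2 x * G.2 x)).
Proof.
move=> [F1 F2] [G1 G2].
rewrite (_ : _ \o _ = ((fun x => (F.1 x * G.1 x)%:E) \+
   (fun x => (F.2 x * G.2 x)%:E))%E); last by apply/funext => x.
by apply: integrableD => //; exact: square_integrableM.
Qed.

Lemma ipC F G : ip F G = ip G F.
Proof. by apply: eq_Rintegral => x _; rewrite mulrC (mulrC (F.2 x)). Qed.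

Lemma ip_combl F c G H : L2pair F -> L2pair G -> L2pair H ->
  ip (pcomb F c G) H = ip F H + c * ip G H.
Proof.
move=> sF sG sH; rewrite /ip -RintegralZl//; last exact: ip_integrable.
rewrite -RintegralD//; [|exact: ip_integrable|].
  by apply: eq_Rintegral => x _ /=; ring.
exact: (integrableZl mD c (ip_integrable sG sH)).
Qed.

Lemma ip_combr F c G H : L2pair F -> L2pair G -> L2pair H ->
  ip H (pcomb F c G) = ip H F + c * ip H G.
Proof. by move=> *; rewrite ipC ip_combl// ipC (ipC G). Qed.

Lemma ip_ge0 F : 0 <= ip F F.
Proof.
by apply: Rintegral_ge0 => x _; rewrite -!expr2 addr_ge0// sqr_ge0.
Qed.

Lemma EFin_ip F : L2pair F -> (ip F F)%:E =
  (\int[mu]_(x in D) ((F.1 x) ^+ 2)%:E + \int[mu]_(x in D) ((F.2 x) ^+ 2)%:E)%E.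
Proof.
move=> sF; have [[m1 _] [m2 _]] := sF.
rewrite /ip /Rintegral fineK; last first.
  by apply: integrable_fin_num => //; exact: ip_integrable.
rewrite -ge0_integralD//.
all: try exact: measurable_sqr.
all: try by move=> x _; rewrite lee_fin sqr_ge0.
Qed.

Lemma quadratic_eq0 (a b : R) : 0 <= b -> (forall t, t * a <= t ^+ 2 * b) -> a = 0.
Proof.
(* This t leads to a^2 (b + 1) <= a^2 b; the + 1 avoids a division by zero. *)
move=> b0 /(_ (a / (b + 1))).
have b1 : 0 < b + 1 by rewrite ltr_pwDr.
have -> : (a / (b + 1)) ^+ 2 * b = a ^+ 2 * b / (b + 1) / (b + 1).
  by field; rewrite gt_eqF.
rewrite mulrAC -expr2 ler_pM2r ?invr_gt0// ler_pdivlMr// => h.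
apply/eqP; rewrite -sqrf_eq0 eq_le sqr_ge0 andbT; lra.
Qed.

Lemma cvg_half : 2^-1 ^+ n @[n --> \oo] --> (0 : R).
Proof.
have := @cvg_geometric R 1 2^-1; rewrite /geometric /=.
under eq_fun do rewrite mul1r.
by apply; rewrite ger0_norm// invf_lt1// ltr1n.
Qed.

Lemma le_limit_half (a b c : R) :
  (forall n, a <= b + c * (2^-1 ^+ n)) -> a <= b.
Proof.
move=> h; have cv : (b + c * (2^-1 ^+ n)) @[n --> \oo] --> b + c * 0.
  apply: cvgD; first exact: cvg_cst.
  apply: cvgM; [exact: cvg_cst|exact: cvg_half].
rewrite mulr0 addr0 in cv.
by apply: (cvgr_to_ge cv); apply: nearW.
Qed.

Variables (W : set V) (g : V).
Hypotheses (W_L2 : forall F, W F -> L2pair F)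
  (W_comb : forall F c G, W F -> W G -> W (pcomb F c G))
  (W_neq0 : W !=set0) (sg : L2pair g).
Hypothesis W_total : forall F, L2pair F -> (forall G, W G -> ip F G = 0) ->
  ip F F = 0.

Local Notation dist F := (ip (pcomb g (-1) F) (pcomb g (-1) F)).
Let q n : R := 2^-1 ^+ n.

(** A sequence minimizing the distance from [g] to [W] is Cauchy; its L^2 limit [p] need not belong
    to [W]. *)
Lemma projection_limit : exists (F_ : nat -> V) (p : V) (m : R),
  [/\ forall n, W (F_ n), L2pair p, forall F, W F -> m <= dist F,
      forall n, dist (F_ n) <= m + q n &
      forall n, ip (pcomb p (-1) (F_ n)) (pcomb p (-1) (F_ n)) <= 2 * q n].
Proof.
pose S := [set dist F | F in W].
have S0 : S !=set0 by have [F WF] := W_neq0; exists (dist F), F.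
have Sl : has_lbound S by exists 0 => _ [F _ <-]; exact: ip_ge0.
have Sinf : has_inf S by split.
pose m := inf S.
have mle F : W F -> m <= dist F by move=> WF; apply: ge_inf => //; exists F.
(* By the parallelogram identity, slacks q^2 / 4 give |F_k - F_n|^2 <= (q_k^2 + q_n^2) / 2, hence
   the rate q_n^2 that [riesz_fischer] expects. *)
have h n : {F | W F /\ dist F <= m + q n ^+ 2 / 4}.
  apply: cid; have e0 : 0 < q n ^+ 2 / 4.
    by rewrite divr_gt0// exprn_gt0// exprn_gt0// invr_gt0.
  have [_ [F WF <-] /ltW ?] := inf_adherent e0 Sinf.
  by exists F.
pose F_ n := sval (h n).
have WF n : W (F_ n) by case: (svalP (h n)).
have dF n : dist (F_ n) <= m + q n ^+ 2 / 4 by case: (svalP (h n)).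
have q01 n : 0 <= q n <= 1.
  by rewrite /q exprn_ge0 ?exprn_ile1 ?invr_ge0// invf_le1// ler1n.
have qmono n k : (n <= k)%N -> q k <= q n.
  by move=> nk; rewrite /q ler_wiXn2l// ?invr_ge0// invf_le1// ler1n.
have sF n : L2pair (F_ n) by exact: W_L2.
(* parallelogram identity at the midpoint of [F_ k] and [F_ n] *)
have cauchy n k : (n <= k)%N ->
    ip (pcomb (F_ k) (-1) (F_ n)) (pcomb (F_ k) (-1) (F_ n)) <= q n ^+ 2.
  move=> nk.
  have := mle _ (W_comb 2^-1 (W_comb (- 2^-1) (WF n) (WF n)) (WF k)).
  have := dF n; have := dF k.
  have : q k ^+ 2 <= q n ^+ 2.
    by rewrite lerXn2r ?nnegrE ?qmono//; [case/andP: (q01 k)|case/andP: (q01 n)].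
  rewrite !(ip_combl, ip_combr)//; try by do ![by []|exact: sF|apply: L2pair_comb].
  rewrite (ipC (F_ n) g) (ipC (F_ k) g) (ipC (F_ k) (F_ n)).
  move: (ip _ _) (ip _ _) (ip _ _) (ip _ _) (ip _ _) (ip _ _) => a1 a2 a3 a4 a5 a6.
  lra.
have comp : forall n k, (n <= k)%N ->
  (\int[mu]_(x in D) (((F_ k).1 x - (F_ n).1 x) ^+ 2)%:E <= (q n ^+ 2)%:E)%E /\
  (\int[mu]_(x in D) (((F_ k).2 x - (F_ n).2 x) ^+ 2)%:E <= (q n ^+ 2)%:E)%E.
  move=> n k nk; have := cauchy _ _ nk.
  rewrite -lee_fin EFin_ip; last exact: L2pair_comb.
  under eq_integral do rewrite /= mulN1r.
  under [X in (_ + X <= _)%E]eq_integral do rewrite /= mulN1r.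
  move=> hle; split; apply: le_trans hle.
    by rewrite leeDl// integral_ge0// => x _; rewrite lee_fin sqr_ge0.
  by rewrite leeDr// integral_ge0// => x _; rewrite lee_fin sqr_ge0.
have [||p1 sp1 hp1] := @riesz_fischer _ _ _ mu D mD Dfin (fun i => (F_ i).1).
- by move=> i; have [] := sF i.
- by move=> i k ik; have [] := comp i k ik.
have [||p2 sp2 hp2] := @riesz_fischer _ _ _ mu D mD Dfin (fun i => (F_ i).2).
- by move=> i; have [] := sF i.
- by move=> i k ik; have [] := comp i k ik.
have q2 n : q n ^+ 2 <= q n.
  by rewrite expr2; have /andP[? ?] := q01 n; rewrite ler_piMr.
exists F_, (p1, p2), m; split => //.
  move=> n; apply: le_trans (dF n) _; rewrite lerD2l.
  by have := q2 n; have /andP[] := q01 n; lra.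
move=> n; rewrite -lee_fin EFin_ip; last exact: L2pair_comb.
under eq_integral do rewrite /= mulN1r.
under [X in (_ + X <= _)%E]eq_integral do rewrite /= mulN1r.
rewrite (_ : 2 * q n = q n + q n); last by ring.
rewrite EFinD; apply: leeD.
  by apply: le_trans (hp1 n) _; rewrite lee_fin q2.
by apply: le_trans (hp2 n) _; rewrite lee_fin q2.
Qed.

Lemma projection_dense (e : R) : 0 < e -> exists2 F, W F & dist F <= e.
Proof.
move=> e0; have [F_ [p [m [WF sp mle dF pF]]]] := projection_limit.
have sF n : L2pair (F_ n) by exact: W_L2.
pose z := pcomb g (-1) p; have sz : L2pair z by exact: L2pair_comb.
have zorth G : W G -> ip z G = 0.
  move=> WG; have sG := W_L2 WG.
  apply: (@quadratic_eq0 _ (ip G G)); first exact: ip_ge0.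
  move=> t.
  (* Minimality at F_n + t G costs 2^-n, and positivity of |F_n - p - t G|^2 costs 2 * 2^-n; half of
     the sum gives 3 / 2. *)
  apply: (@le_limit_half _ _ (3 / 2)) => n.
  have h1 := mle _ (W_comb t (WF n) WG).
  have h2 := ip_ge0 (pcomb (pcomb (F_ n) (-1) p) (- t) G).
  have := dF n; have := pF n; move: h1 h2.
  rewrite /z !(ip_combl, ip_combr)//; try by do ![by []|exact: sF|apply: L2pair_comb].
  rewrite (ipC (F_ n) g) (ipC G g) (ipC G (F_ n)) (ipC p (F_ n)) (ipC G p).
  rewrite /q.
  move: (ip _ _) (ip _ _) (ip _ _) (ip _ _) (ip _ _) (ip _ _) (ip _ _) (ip _ _) => *.
  lra.
have z0 := W_total sz zorth.
(* |g - F_N|^2 <= 2 |z|^2 + 2 |p - F_N|^2, where the first term vanishes and the second is at most 4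
   * 2^-N. *)
have e4 : 0 < e / 4 by rewrite divr_gt0.
have [N _ /(_ N (leqnn _)) /= qN] := cvgr_lt _ cvg_half _ e4.
exists (F_ N) => //; rewrite -/(q N) in qN.
have h := ip_ge0 (pcomb z (-1) (pcomb p (-1) (F_ N))).
have h' := pF N.
move: h h' z0; rewrite /z !(ip_combl, ip_combr)//; try by do ![by []|exact: sF|apply: L2pair_comb].
rewrite (ipC (F_ N) g) (ipC p g) (ipC (F_ N) p).
move: (ip _ _) (ip _ _) (ip _ _) (ip _ _) (ip _ _) (ip _ _) => *.
lra.
Qed.

End Projection.

(** * Trigonometric polynomials *)

Section Trigonometric.
Context (R : realType) (d : nat).
Implicit Types (l x y z : 'rV[R]_d).
Local Notation term := ('rV[R]_d * (R * R))%type.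

Lemma dotRdDr l x y : dotRd l (x + y) = dotRd l x + dotRd l y.
Proof. by rewrite -big_split; apply: eq_bigr => i _; rewrite mxE mulrDr. Qed.

Lemma dotRdBl l l' x : dotRd (l - l') x = dotRd l x - dotRd l' x.
Proof. by rewrite -sumrB; apply: eq_bigr => i _; rewrite !mxE mulrBl. Qed.

Lemma ecosD l x y :
  ecos l (x + y) = ecos l x * ecos l y - esin l x * esin l y.
Proof. by rewrite /ecos dotRdDr mulrDr cosD. Qed.

Lemma esinD l x y :
  esin l (x + y) = esin l x * ecos l y + ecos l x * esin l y.
Proof. by rewrite /esin dotRdDr mulrDr sinD. Qed.

Lemma ecosB l l' x :
  ecos (l - l') x = ecos l x * ecos l' x + esin l x * esin l' x.
Proof. by rewrite /ecos dotRdBl mulrBr cosB. Qed.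

Lemma esinB l l' x :
  esin (l - l') x = esin l x * ecos l' x - ecos l x * esin l' x.
Proof. by rewrite /esin dotRdBl mulrBr sinB. Qed.

Lemma ecos2Desin2 l x : ecos l x ^+ 2 + esin l x ^+ 2 = 1.
Proof. exact: cos2Dsin2. Qed.

Lemma measurable_dotRd l :
  measurable_fun setT (fun x : LebRd R d => dotRd l x).
Proof.
apply: measurable_sum => i; apply: measurable_funM.
  exact: measurable_cst.
exact: measurable_coord.
Qed.

Lemma measurable_ecos l : measurable_fun setT (ecos l : LebRd R d -> R).
Proof.
apply: (measurableT_comp (f := @cos R)); last first.
  by apply: measurable_funM; [exact: measurable_cst|exact: measurable_dotRd].
by apply: continuous_measurable_fun; exact: continuous_cos.
Qed.

Lemma measurable_esin l : measurable_fun setT (esin l : LebRd R d -> R).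
Proof.
apply: (measurableT_comp (f := @sin R)); last first.
  by apply: measurable_funM; [exact: measurable_cst|exact: measurable_dotRd].
by apply: continuous_measurable_fun; exact: continuous_sin.
Qed.

(* A term [(l, (a, b))] stands for [(a + i b) e^{2 pi i <l, x>}]; the two
   components of [trig] are real and imaginary parts. *)
Definition trig (s : seq term) : (LebRd R d -> R) * (LebRd R d -> R) :=
  (fun x => \sum_(t <- s) (t.2.1 * ecos t.1 x - t.2.2 * esin t.1 x),
   fun x => \sum_(t <- s) (t.2.1 * esin t.1 x + t.2.2 * ecos t.1 x)).

Definition scale_term (c : R) (t : term) : term :=
  (t.1, (c * t.2.1, c * t.2.2)).

(** Multiplies the coefficient by e^{2 pi i <l, z>}, which is how translation by [z] acts on a
    term. *)
Definition rotate_term z (t : term) : term :=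
  (t.1, (t.2.1 * ecos t.1 z - t.2.2 * esin t.1 z,
         t.2.1 * esin t.1 z + t.2.2 * ecos t.1 z)).

Lemma pcomb_trig s s' c :
  pcomb (trig s) c (trig s') = trig (s ++ map (scale_term c) s').
Proof.
by rewrite /pcomb /trig; congr pair; apply/funext => x /=;
  rewrite big_cat big_map /= mulr_sumr; congr (_ + _);
  apply: eq_bigr => t _; ring.
Qed.

Lemma trig_cons t s : trig (t :: s) = pcomb (trig [:: t]) 1 (trig s).
Proof.
by rewrite /pcomb /trig; congr pair; apply/funext => x /=;
  rewrite big_cons big_seq1 mul1r.
Qed.

Lemma trigD1 s x z : (trig s).1 (x + z) = (trig (map (rotate_term z) s)).1 x.
Proof.
by rewrite /trig /= big_map; apply: eq_bigr => t _ /=;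
  rewrite ecosD esinD; ring.
Qed.

Lemma trigD2 s x z : (trig s).2 (x + z) = (trig (map (rotate_term z) s)).2 x.
Proof.
by rewrite /trig /= big_map; apply: eq_bigr => t _ /=;
  rewrite ecosD esinD; ring.
Qed.

Lemma measurable_trig1 s : measurable_fun setT (trig s).1.
Proof.
apply: measurable_sum => t; apply: measurable_funB; apply: measurable_funM.
- exact: measurable_cst.
- exact: measurable_ecos.
- exact: measurable_cst.
- exact: measurable_esin.
Qed.

Lemma measurable_trig2 s : measurable_fun setT (trig s).2.
Proof.
apply: measurable_sum => t; apply: measurable_funD; apply: measurable_funM.
- exact: measurable_cst.
- exact: measurable_esin.
- exact: measurable_cst.
- exact: measurable_ecos.
Qed.

Context (Om : set (LebRd R d)) (L : set 'rV[R]_d).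
Hypotheses (mOm : measurable Om) (Omfin : (lebRd Om < +oo)%E).
Local Notation mu := (@lebRd R d).
Local Notation ip := (ip mu Om).
Local Notation L2 := (L2pair mu Om).

Lemma bounded_square_integrable (f : LebRd R d -> R) (C : R) :
  measurable_fun setT f -> (forall x, `|f x| <= C) ->
  square_integrable mu Om f.
Proof.
move=> mf fC; have mf' : measurable_fun Om f by exact: measurable_funTS.
split => //; apply: (@le_lt_trans _ _ (\int[mu]_(x in Om) (C ^+ 2)%:E)%E).
  apply: ge0_le_integral; first exact: mOm.
  - by move=> x _; rewrite lee_fin sqr_ge0.
  - exact: measurable_sqr.
  - exact: measurable_cst.
  - move=> x _; rewrite lee_fin -[f x ^+ 2]real_normK ?num_real//.
    by rewrite lerXn2r ?nnegrE// (le_trans _ (fC x)).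
by rewrite integral_cst// lte_mul_pinfty ?lee_fin ?sqr_ge0.
Qed.

Lemma square_integrable_ecos l : square_integrable mu Om (ecos l).
Proof.
apply: (@bounded_square_integrable _ 1); first exact: measurable_ecos.
by move=> x; rewrite ler_norml cos_geN1 cos_le1.
Qed.

Lemma square_integrable_esin l : square_integrable mu Om (esin l).
Proof.
apply: (@bounded_square_integrable _ 1); first exact: measurable_esin.
by move=> x; rewrite ler_norml sin_geN1 sin_le1.
Qed.

Lemma square_integrable_cst (c : R) : square_integrable mu Om (cst c).
Proof.
by apply: (@bounded_square_integrable _ `|c|) => //; exact: measurable_cst.
Qed.

Lemma square_integrable_integrable (f : LebRd R d -> R) :
  square_integrable mu Om f -> mu.-integrable Om (EFin \o f).
Proof.
move=> sf; have := square_integrableM mOm sf (square_integrable_cst 1).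
by congr (_.-integrable); apply/funext => x; rewrite mulr1.
Qed.

Lemma trig_L2 s : L2 (trig s).
Proof.
have hc := square_integrable_ecos; have hs := square_integrable_esin.
have h0 := square_integrable_cst 0.
elim: s => [|t s IH].
  by split; rewrite /trig /= (_ : (fun _ => _) = cst 0)//;
    apply/funext => x; rewrite big_nil.
rewrite trig_cons; apply: L2pair_comb => //; split.
  have := square_integrableD mOm (- t.2.2) (square_integrableD mOm t.2.1 h0 (hc t.1)) (hs t.1).
  congr square_integrable; apply/funext => x; rewrite /= big_seq1 /=; ring.
have := square_integrableD mOm t.2.2 (square_integrableD mOm t.2.1 h0 (hs t.1)) (hc t.1).
congr square_integrable; apply/funext => x; rewrite /= big_seq1 /=; ring.
Qed.

Hypothesis orthL : forall l m, L l -> L m -> l <> m ->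
  (\int[mu]_(x in Om) (ecos (l - m) x)%:E = 0)%E /\
  (\int[mu]_(x in Om) (esin (l - m) x)%:E = 0)%E.

(** Equal frequencies: both coefficients are multiplied by the same unit number. Distinct
    frequencies: both sides vanish by orthogonality, whatever the coefficients. *)
Lemma ip_rotate_term z t t' : L t.1 -> L t'.1 ->
  ip (trig [:: rotate_term z t]) (trig [:: rotate_term z t']) =
  ip (trig [:: t]) (trig [:: t']).
Proof.
have ipE u u' : ip (trig [:: u]) (trig [:: u']) =
  \int[mu]_(x in Om)
    ((u.2.1 * u'.2.1 + u.2.2 * u'.2.2) * ecos (u.1 - u'.1) x +
     (u.2.1 * u'.2.2 - u.2.2 * u'.2.1) * esin (u.1 - u'.1) x).
  apply: eq_Rintegral => x _; rewrite /= !big_seq1 ecosB esinB; ring.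
move=> Lt Lt'; have [tt|/eqP tt] := eqVneq t.1 t'.1.
  rewrite !ipE; apply: eq_Rintegral => x _ /=; rewrite tt ecosB esinB.
  set A := ecos t'.1 x; set B := esin t'.1 x.
  rewrite (mulrC B A) subrr !mulr0 !addr0; congr (_ * _).
  transitivity ((t.2.1 * t'.2.1 + t.2.2 * t'.2.2) *
    (ecos t'.1 z ^+ 2 + esin t'.1 z ^+ 2)); first by ring.
  by rewrite ecos2Desin2 mulr1.
suff ip0 u u' : u.1 = t.1 -> u'.1 = t'.1 -> ip (trig [:: u]) (trig [:: u']) = 0.
  by rewrite !ip0.
move=> ut ut'; rewrite ipE ut ut'.
have [c0 s0] := orthL Lt Lt' tt.
have Ic := square_integrable_integrable (square_integrable_ecos (t.1 - t'.1)).
have Is := square_integrable_integrable (square_integrable_esin (t.1 - t'.1)).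
rewrite RintegralD//; last 2 first.
- exact: (integrableZl mOm _ Ic).
- exact: (integrableZl mOm _ Is).
rewrite !RintegralZl// /Rintegral c0 s0 /=; ring.
Qed.

(** Bilinearity extends the case of single terms. For s = s' this makes the L^2(Omega) norm of a
    polynomial invariant under translation of the polynomial. *)
Lemma ip_rotate z s s' : (forall t, t \in s -> L t.1) ->
  (forall t, t \in s' -> L t.1) ->
  ip (trig (map (rotate_term z) s)) (trig (map (rotate_term z) s')) =
  ip (trig s) (trig s').
Proof.
have tL2 := trig_L2.
elim: s s' => [s' _ _|t s IH s' sL s'L].
  by apply: eq_Rintegral => x _; rewrite /= !big_nil !mul0r.
rewrite /= (trig_cons (rotate_term z t)) (trig_cons t) !ip_combl// IH//; last first.
  by move=> u us; apply: sL; rewrite inE us orbT.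
congr (_ + _); have Lt : L t.1 by apply: sL; rewrite mem_head.
elim: s' s'L {IH} => [_|t' s' IH' s'L].
  by apply: eq_Rintegral => x _; rewrite /= !big_nil !mulr0.
rewrite /= (trig_cons (rotate_term z t')) (trig_cons t') !ip_combr// IH'//; last first.
  by move=> u us; apply: s'L; rewrite inE us orbT.
by rewrite ip_rotate_term// ; apply: s'L; rewrite mem_head.
Qed.

Hypothesis totL : forall u v : LebRd R d -> R, L2_on Om u -> L2_on Om v ->
  (forall l, L l ->
    (\int[mu]_(x in Om) (u x * ecos l x + v x * esin l x)%:E = 0)%E /\
    (\int[mu]_(x in Om) (v x * ecos l x - u x * esin l x)%:E = 0)%E) ->
  {ae mu, forall x, Om x -> u x = 0 /\ v x = 0}.

(** [W] is a real subspace, but its complex coefficients make orthogonality for the real product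
    [ip] yield both the real and the imaginary condition of completeness. *)
Lemma trig_dense (g : (LebRd R d -> R) * (LebRd R d -> R)) (e : R) :
  L2 g -> 0 < e -> exists s : seq term, (forall t, t \in s -> L t.1) /\
    ip (pcomb g (-1) (trig s)) (pcomb g (-1) (trig s)) <= e.
Proof.
move=> sg e0.
pose W := [set trig s | s in [set s : seq term | forall t, t \in s -> L t.1]].
have W_L2 F : W F -> L2 F by move=> [s _ <-]; exact: trig_L2.
have W_comb F c H : W F -> W H -> W (pcomb F c H).
  move=> [s hs <-] [s' hs' <-]; rewrite pcomb_trig; exists (s ++ map (scale_term c) s') => //.
  move=> t; rewrite mem_cat => /orP[/hs //|/mapP[u /hs' Lu ->]]//.
have W0 : W !=set0 by exists (trig [::]), [::].
suff W_tot F : L2 F -> (forall H, W H -> ip F H = 0) -> ip F F = 0.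
  by have [_ [s hs <-] h] := projection_dense mOm Omfin W_L2 W_comb W0 sg W_tot e0; exists s.
move=> sF FW.
have F0 s : (forall t, t \in s -> L t.1) ->
    (\int[mu]_(x in Om) (F.1 x * (trig s).1 x + F.2 x * (trig s).2 x)%:E = 0)%E.
  move=> hs; have := FW (trig s) (ex_intro2 _ _ s hs erefl).
  have := ip_integrable mOm sF (trig_L2 s).
  move/(integrable_fin_num mOm) => /= fn; rewrite /ip /Rintegral => h.
  by rewrite -(fineK fn) h.
have := totL sF.1 sF.2; case.
  move=> l Ll; split.
    (* The coefficient 1 tests the real part of <F, e_l>; the coefficient i, below, tests the
       imaginary part. *)
    rewrite -[RHS](F0 [:: (l, (1, 0))]).
      by apply: eq_integral => x _; rewrite /= !big_seq1 /=; congr EFin; ring.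
    by move=> t; rewrite inE => /eqP ->.
  rewrite -[RHS](F0 [:: (l, (0, 1))]).
    by apply: eq_integral => x _; rewrite /= !big_seq1 /=; congr EFin; ring.
  by move=> t; rewrite inE => /eqP ->.
move=> N [mN N0 hN].
apply: EFin_inj; rewrite EFin_ip//; have [[m1 _] [m2 _]] := sF.
have z (f : LebRd R d -> R) : measurable_fun Om f ->
    (forall x, Om x -> ~ N x -> f x = 0) ->
    (\int[mu]_(x in Om) ((f x) ^+ 2)%:E = 0)%E.
  move=> mf fN.
  have f0 x : Om x -> (0 <= (f x ^+ 2)%:E)%E by rewrite lee_fin sqr_ge0.
  rewrite (ge0_negligible_integral mN mOm (measurable_sqr mf) f0 N0).
  rewrite -[RHS](integral0 mu (Om `\` N)); apply: eq_integral => x /[!inE] -[Ox Nx].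
  by rewrite fN// expr0n.
rewrite !z ?adde0// => x Ox Nx; apply: contrapT => h; apply: Nx; apply: hN => /=;
  by move=> /(_ Ox) [].
Qed.

(** Approximate the indicator of [G] in L^2(Omega) by a polynomial p and take rho = |p|^2: outside
    [G] the squared error is rho itself, so little mass lies there. *)
Lemma concentrated_density (G : set (LebRd R d)) (e : R) :
  measurable G -> G `<=` Om -> (0 < mu G)%E -> 0 < e -> e <= 1 ->
  exists (rho : LebRd R d -> R) (M : R),
    [/\ measurable_fun setT rho, forall x, 0 <= rho x, 0 < M,
        forall z, (\int[mu]_(x in Om) (rho (x + z))%:E = M%:E)%E &
        (((1 - e) * M)%:E <= \int[mu]_(x in G) (rho x)%:E)%E].
Proof.
move=> mG GOm G0 e0 e1.
have Gfn : mu G \is a fin_num.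
  by rewrite ge0_fin_numE//; apply: le_lt_trans Omfin; apply: le_measure; rewrite ?inE.
have fG0 : 0 < fine (mu G) by rewrite fine_gt0// G0 ltey_eq Gfn.
(* With this choice [Mlow] yields mu G / 4 <= M, so that the error e' is at most e M. *)
pose e' := e * fine (mu G) / 4.
have e'0 : 0 < e' by rewrite divr_gt0// mulr_gt0.
pose g : (LebRd R d -> R) * (LebRd R d -> R) := (\1_G, cst 0).
have sg : L2 g.
  split.
    apply: (@bounded_square_integrable _ 1); first exact: measurable_indic.
    by move=> x; rewrite /= indicE; case: (_ \in _); rewrite ?normr1 ?normr0.
  exact: square_integrable_cst.
have [s [hs hd]] := trig_dense sg e'0.
pose rho : LebRd R d -> R := fun x => (trig s).1 x ^+ 2 + (trig s).2 x ^+ 2.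
pose M := ip (trig s) (trig s).
have mrho : measurable_fun setT rho.
  by apply: measurable_funD; apply: measurable_funX;
    [exact: measurable_trig1|exact: measurable_trig2].
have rho0 x : 0 <= rho x by rewrite addr_ge0 ?sqr_ge0.
have IM z : (\int[mu]_(x in Om) (rho (x + z))%:E = M%:E)%E.
  rewrite -[M](ip_rotate z hs hs) /ip /Rintegral fineK.
    by apply: eq_integral => x _; rewrite /rho trigD1 trigD2 !expr2.
  by apply: integrable_fin_num => //; apply: ip_integrable => //; exact: trig_L2.
have IM0 : (\int[mu]_(x in Om) (rho x)%:E = M%:E)%E.
  by rewrite -(IM 0); apply: eq_integral => x _; rewrite addr0.
pose err : LebRd R d -> R := fun x => (\1_G x - (trig s).1 x) ^+ 2 + (trig s).2 x ^+ 2.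
have merr : measurable_fun setT err.
  apply: measurable_funD; apply: measurable_funX; last exact: measurable_trig2.
  by apply: measurable_funB; [exact: measurable_indic|exact: measurable_trig1].
have err0 x : 0 <= err x by rewrite addr_ge0 ?sqr_ge0.
have Ierr : (\int[mu]_(x in Om) (err x)%:E <= e'%:E)%E.
  apply: le_trans (_ : (ip (pcomb g (-1) (trig s)) (pcomb g (-1) (trig s)))%:E <= _)%E.
    rewrite /ip /Rintegral fineK.
      rewrite le_eqVlt; apply/orP; left; apply/eqP.
      by apply: eq_integral => x _; rewrite /err /=; congr EFin; ring.
    by apply: integrable_fin_num => //; apply: ip_integrable => //;
      apply: L2pair_comb => //; exact: trig_L2.
  by rewrite lee_fin.
have mrD (D : set (LebRd R d)) : measurable_fun D (EFin \o rho).
  by apply/measurable_EFinP; exact: measurable_funTS.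
have meD (D : set (LebRd R d)) : measurable_fun D (EFin \o err).
  by apply/measurable_EFinP; exact: measurable_funTS.
have r0 (D : set (LebRd R d)) x : D x -> (0 <= (rho x)%:E)%E by rewrite lee_fin.
have er0 (D : set (LebRd R d)) x : D x -> (0 <= (err x)%:E)%E by rewrite lee_fin.
have mD : measurable (Om `\` G) by exact: measurableD.
have Mlow : fine (mu G) <= 2 * M + 2 * e'.
  have -> : fine (mu G) = ip g g.
    apply: EFin_inj; rewrite EFin_ip// fineK//.
    have h0 : (\int[mu]_(x in Om) (g.2 x ^+ 2)%:E = 0)%E.
      by rewrite -[RHS](integral0 mu Om); apply: eq_integral => x _; rewrite /= expr0n.
    have h1 : (\int[mu]_(x in Om) (g.1 x ^+ 2)%:E = mu G)%E.
      have := integral_indic mu mOm mG; rewrite setIidl// => <-.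
      by apply: eq_integral => x _; rewrite /= indicE; case: (_ \in _);
        rewrite ?expr1n ?expr0n.
    by rewrite h0 h1 adde0.
  have sp := trig_L2 s.
  (* 0 <= |g - 2 p|^2 is a form of |g|^2 <= 2 |p|^2 + 2 |g - p|^2. *)
  have := ip_ge0 mu Om (pcomb g (-2) (trig s)); move: hd; rewrite /M.
  rewrite !(ip_combl, ip_combr)//; try by apply: L2pair_comb.
  rewrite (ipC _ _ (trig s) g).
  move: (ip _ _) (ip _ _) (ip _ _) => *; lra.
have e'M : e' <= e * M.
  rewrite /e'.
  have h : e * fine (mu G) <= fine (mu G) by rewrite ler_piMl// ltW.
  have : fine (mu G) / 4 <= M by rewrite /e' in Mlow; lra.
  by rewrite -(ler_pM2l e0) mulrA.
have M0 : 0 < M by rewrite -(pmulr_rgt0 _ e0); exact: lt_le_trans e'M.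
exists rho, M; split => //.
have GU : Om = G `|` (Om `\` G) by rewrite setDUK.
have : (M%:E = \int[mu]_(x in G) (rho x)%:E + \int[mu]_(x in Om `\` G) (rho x)%:E)%E.
  rewrite -IM0 {1}GU; apply: ge0_integral_setU;
    [exact: mG|exact: mD|exact: mrD|exact: r0|].
  by apply/disj_setPS => x [] ? [].
have : (\int[mu]_(x in Om `\` G) (rho x)%:E <= e'%:E)%E.
  apply: le_trans Ierr.
  apply: (@le_trans _ _ (\int[mu]_(x in Om `\` G) (err x)%:E)%E).
    apply: ge0_le_integral;
      [exact: mD|exact: r0|exact: mrD|exact: meD|].
    move=> x [_ Gx]; rewrite lee_fin /rho /err indicE memNset//=.
    by rewrite sub0r sqrrN.
  by apply: (ge0_subset_integral mu mD mOm (meD Om) (@er0 Om)) => x [].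
case: (\int[mu]_(x in Om `\` G) (rho x)%:E)%E => [a||] //; last first.
  by move=> _; case: (\int[mu]_(x in G) (rho x)%:E)%E.
case: (\int[mu]_(x in G) (rho x)%:E)%E => [b||] //.
rewrite !lee_fin => ae' [Mab]; lra.
Qed.

End Trigonometric.

(** * Overlap functions *)

Section Overlap.
Context (R : realType) (d : nat).
Implicit Types (x y z : 'rV[R]_d) (A B E X : set (LebRd R d)).
Local Notation BorelRd := (g_sigma_algebraType (@boxes R d)).
Local Notation mu := (@lebRd R d).

Lemma integral_shift (f : LebRd R d -> \bar R) z :
  measurable_fun setT f -> (forall x, 0 <= f x)%E ->
  (\int[mu]_x f (x + z)%R = \int[mu]_x f x)%E.
Proof.
move=> mf f0.
have mz : measurable_fun [set: LebRd R d] (fun x : LebRd R d => (x + z : LebRd R d)).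
  move=> _ A mA; rewrite setTI; exact: measurable_shift.
have := @ge0_integral_pushforward _ _ _ _ R _ mz mu setT f measurableT mf
  (fun x _ => f0 x).
rewrite preimage_setT => <-; apply: eq_measure_integral => A mA _.
exact: lebesgue_outer_shift.
Qed.

Definition overlap X E x : R := fine (mu (X `&` shiftset E x)).

Lemma EFin_overlap X E x : (mu X < +oo)%E ->
  (overlap X E x)%:E = mu (X `&` shiftset E x).
Proof.
move=> Xfin; rewrite fineK// ge0_fin_numE; last exact: outer_measure_ge0.
by apply: le_lt_trans Xfin; apply: le_outer_measure => y [].
Qed.

Lemma overlap_ge0 X E x : 0 <= overlap X E x.
Proof. by rewrite fine_ge0//; exact: outer_measure_ge0. Qed.

Lemma overlap_le X E x : (mu X < +oo)%E -> overlap X E x <= fine (mu X).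
Proof.
move=> Xfin; rewrite -lee_fin EFin_overlap// fineK.
  by apply: le_outer_measure => y [].
by rewrite ge0_fin_numE//; exact: outer_measure_ge0.
Qed.

(** What is lost in passing from [x] to [y] lies in a translate of [E] minus [shiftset E (y - x)],
    so the continuity is uniform in [x]. *)
Lemma overlap_near X E (e : R) : (mu X < +oo)%E -> measurable E ->
  (mu E < +oo)%E -> 0 < e -> exists2 t : R, 0 < t &
  forall x y, (forall i, `|(y - x) ord0 i| < t) ->
    overlap X E x <= overlap X E y + e.
Proof.
move=> Xfin mE Efin e0.
have [t t0 ht] := shift_continuous_measurable mE Efin e0.
exists t => // x y /ht h; rewrite -lee_fin EFinD !EFin_overlap//.
apply: (@le_trans _ _ (mu ((X `&` shiftset E y) `|`
   shiftset (E `\` shiftset E (y - x)) x))).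
  apply: le_outer_measure => w [Xw Ew].
  have [Ey|nEy] := pselect (E (w + y)); [by left|right; split => //].
  by rewrite /shiftset /= -addrA (addrC x) subrK.
apply: le_trans (outer_measureU2 _ _ _) _; apply: leeD => //.
by apply: le_trans (lebesgue_outer_shift_le _ _) h.
Qed.

(** Addition is measurable, coordinate by coordinate, into the Borel structure; this is where the
    Borel hull is called for. *)
Lemma measurable_sum_preimage E : measurable (E : set BorelRd) ->
  measurable [set p : LebRd R d * LebRd R d | E (p.1 + p.2)].
Proof.
move=> mE.
have m i : measurable_fun [set: LebRd R d * LebRd R d]
    (fun p : LebRd R d * LebRd R d => (p.1 + p.2 : 'rV[R]_d) ord0 i).
  rewrite (_ : (fun _ => _) = (fun p : LebRd R d * LebRd R d =>
    p.1 ord0 i + p.2 ord0 i)); last by apply/funext => p; rewrite mxE.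
  apply: measurable_funD.
    exact: (measurableT_comp (@measurable_coord R d i) measurable_fst).
  exact: (measurableT_comp (@measurable_coord R d i) measurable_snd).
by have /(_ measurableT E mE) := measurable_to_borel m; rewrite setTI.
Qed.

Section Tonelli.
Variables (X E : set (LebRd R d)) (rho : LebRd R d -> R).
Hypotheses (mX : measurable X) (mE : measurable (E : set BorelRd))
  (mrho : measurable_fun setT rho) (rho0 : forall x, 0 <= rho x).
Hypothesis Xfin : (mu X < +oo)%E.

Let f (p : LebRd R d * LebRd R d) : \bar R :=
  (rho p.1 * (\1_X p.2 * \1_[set p : LebRd R d * LebRd R d | E (p.1 + p.2)] p))%:E.

Let mf : measurable_fun setT f.
Proof.
apply/measurable_EFinP; apply: measurable_funM.
  exact: (measurableT_comp mrho measurable_fst).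
apply: measurable_funM.
  have mI : measurable_fun setT (\1_X : LebRd R d -> R).
    exact: measurable_indic.
  exact: (measurableT_comp mI measurable_snd).
apply: measurable_indic; exact: measurable_sum_preimage.
Qed.

Let f0 p : (0 <= f p)%E.
Proof. by rewrite lee_fin !mulr_ge0. Qed.

Let fE x : (\int[mu]_y f (x, y) = (rho x * overlap X E x)%:E)%E.
Proof.
rewrite EFinM EFin_overlap//.
have mXE : measurable (X `&` shiftset E x).
  by apply: measurableI => //; apply: measurable_shift; exact: borel_measurable.
rewrite -[X in (_ * mu X)%E]setIT -(integral_indic mu measurableT mXE).
have mI : measurable_fun [set: LebRd R d]
    (fun y => (\1_(X `&` shiftset E x) y : R)%:E).
  by apply/measurable_EFinP; exact: measurable_indic.
have I0 y : [set: LebRd R d] y -> (0 <= (\1_(X `&` shiftset E x) y)%:E :> \bar R)%E.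
  by rewrite lee_fin.
have r0 : (0 <= (rho x)%:E)%E by rewrite lee_fin.
rewrite -(ge0_integralZl mu measurableT mI I0 r0).
by apply: eq_integral => y _; rewrite /f /= -EFinM; congr (_ * _)%:E;
  rewrite !indicE -natrM mulnb in_setI; congr ((_ && _)%:R);
  apply/idP/idP; rewrite !inE /shiftset /= addrC.
Qed.

Lemma measurable_rho_overlap :
  measurable_fun setT
  (fun x : LebRd R d => (rho x * overlap X E x)%:E).
Proof.
have := @measurable_fun_fubini_tonelli_F _ _ _ _ R mu f mf f0.
by congr measurable_fun; apply/funext => x; rewrite -fE.
Qed.

(** The inner integral on the right is the mass of [rho] on a translate of [E], which is the same
    for all y when [rho] comes from a spectrum. *)
Lemma tonelli_overlap :
  (\int[mu]_x (rho x * overlap X E x)%:E =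
   \int[mu]_(y in X) \int[mu]_x (rho x * \1_E (x + y))%:E)%E.
Proof.
under eq_integral do rewrite -fE.
rewrite (@fubini_tonelli _ _ _ _ R mu mu f mf f0).
rewrite [RHS]integral_mkcond; apply: eq_integral => y _.
rewrite patchE; case: ifPn => [yX|yX].
  apply: eq_integral => x _; rewrite /f /= [\1_X y]indicE yX mul1r.
  by congr ((_ * _)%:E); rewrite !indicE; congr (_%:R); apply/idP/idP; rewrite !inE.
rewrite -[RHS](integral0 mu setT); apply: eq_integral => x _.
by rewrite /f /= [\1_X y]indicE (negbTE yX) mul0r mulr0.
Qed.

End Tonelli.

End Overlap.

(** * Comparison of two overlaps by compactness, and small pieces of positive measure *)

Section Compactness.
Context (R : realType) (d : nat).
Implicit Types (x y z : 'rV[R]_d) (A B E X S Om : set (LebRd R d)).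
Local Notation BorelRd := (g_sigma_algebraType (@boxes R d)).
Local Notation mu := (@lebRd R d).

Lemma bounded_seq_cluster (K : R) (x_ : nat -> 'rV[R]_d) :
  (forall n i, `|x_ n ord0 i| <= K) -> exists x : 'rV[R]_d,
  forall t : R, 0 < t -> forall N, exists2 n, (N <= n)%N &
    forall i, `|(x - x_ n) ord0 i| < t.
Proof.
move=> xK.
have cK := @rV_compact R d (fun=> `[- K, K]%classic)
  (fun=> @segment_compact R (- K) K).
have xnK : (x_ @ \oo) [set v | forall i, `[- K, K]%classic (v ord0 i)].
  by exists 0%N => // n _ i /=; rewrite in_itv /= -ler_norml.
have [x [_ xF]] := cK _ (fmap_proper_filter x_ eventually_filter) xnK.
exists x => t t0 N.
(* Every ball around a cluster point meets the image of every tail. *)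
have [|_ [[n Nn <-] xn]] := xF [set x_ n | n in [set n | (N <= n)%N]] (ball x t) _
  (nbhsx_ballx _ _ t0).
  by exists N => // n Nn; exists n.
exists n => // i; rewrite !mxE; case: xn => _ /(_ ord0 i).
by [].
Qed.

(** Otherwise some bounded sequence has [X]-overlaps tending to 0 and [S]-overlaps at least [eta];
    by continuity a cluster point would have a positive [S]-overlap and no [X]-overlap. *)
Lemma overlap_uniform_pos X S E (K eta : R) :
  measurable E -> (mu E < +oo)%E -> (mu X < +oo)%E -> (mu S < +oo)%E ->
  (forall x, 0 < overlap S E x -> 0 < overlap X E x) -> 0 < eta ->
  exists2 c : R, 0 < c & forall x, (forall i, `|x ord0 i| <= K) ->
    eta <= overlap S E x -> c <= overlap X E x.
Proof.
move=> mE Efin Xfin Sfin SX eta0; apply: contrapT => h.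
have bad n : {x : 'rV[R]_d | [/\ (forall i, `|x ord0 i| <= K),
    eta <= overlap S E x & overlap X E x < n.+1%:R^-1]}.
  apply: cid; apply: contrapT => /forallNP h'.
  apply: h; exists n.+1%:R^-1; first by rewrite invr_gt0.
  move=> x xK Sx.
  by rewrite leNgt; apply/negP => Xx; apply: (h' x).
pose x_ n := sval (bad n).
have xK n : forall i, `|x_ n ord0 i| <= K by case: (svalP (bad n)).
have Sx n : eta <= overlap S E (x_ n) by case: (svalP (bad n)).
have Xx n : overlap X E (x_ n) < n.+1%:R^-1 by case: (svalP (bad n)).
have [x xcl] := bounded_seq_cluster xK.
have clN (t : R) : 0 < t -> forall N, exists2 n, (N <= n)%N &
    forall i, `|(x_ n - x) ord0 i| < t.
  move=> t0 N; have [n Nn hn] := xcl t t0 N; exists n => // i.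
  by have := hn i; rewrite !mxE distrC.
have : 0 < overlap S E x.
  have e20 : 0 < eta / 2 by rewrite divr_gt0.
  have [t t0 ht] := overlap_near Sfin mE Efin e20.
  have [n _ hn] := xcl t t0 0%N.
  by have := ht _ _ hn; have := Sx n; lra.
(* One half of the value at [x] is left to the continuity error, the other to the bound 1 / (n + 1),
   which is at most [e] once n >= truncn e^-1. *)
move=> /SX Xpos; pose e : R := overlap X E x / 2.
have e0 : 0 < e by rewrite divr_gt0.
have [t t0 ht] := overlap_near Xfin mE Efin e0.
have [n Nn hn] := clN t t0 (Num.truncn e^-1).
have := ht _ _ hn; have := Xx n.
have ne : n.+1%:R^-1 <= e.
  rewrite -[leRHS]invrK lef_pV2 ?posrE ?invr_gt0//.
  have ei0 : 0 <= e^-1 by rewrite invr_ge0 ltW.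
  have /andP[_ /ltW] := Num.Theory.truncn_itv ei0.
  by move/le_trans; apply; rewrite ler_nat.
move=> h1 h2; have h3 := lt_le_trans h1 ne.
have h4 : overlap X E x = e + e by rewrite /e -splitr.
by move: h2; rewrite h4 lerD2r leNgt h3.
Qed.

Lemma cube_subset (r s : R) : r <= s -> cube r `<=` (cube s : set 'rV[R]_d).
Proof.
move=> rs x /cubeP h; apply/cubeP => i.
by have /andP[h1 h2] := h i; apply/andP; split; lra.
Qed.

Lemma exists_pos_cube (Om : set (LebRd R d)) :
  (0 < mu Om)%E -> exists n, (0 < mu (Om `&` cube n.+1%:R))%E.
Proof.
move=> Om0; apply: contrapT => /forallNP h.
have : (mu Om <= 0)%E; last by rewrite leNgt Om0.
apply: (@le_trans _ _ (mu (\bigcup_n (Om `&` cube n.+1%:R)))).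
  by rewrite -setI_bigcupr bigcup_cube setIT.
apply: le_trans (outer_measure_sigma_subadditive _ _) _.
rewrite eseries0// => n _ _; apply/eqP; rewrite eq_le outer_measure_ge0 andbT.
by rewrite leNgt; apply/negP; exact: h.
Qed.

Lemma exists_pos_small_piece (Om : set (LebRd R d)) (r : R) : 0 < r ->
  (0 < mu Om)%E -> exists c : 'rV[R]_d, (0 < mu (Om `&` shiftset (cube r) (- c)))%E.
Proof.
move=> r0 Om0; apply: contrapT => /forallNP h.
have : (mu Om <= 0)%E; last by rewrite leNgt Om0.
(* The cubes have side 2 r on a grid of step r, so they overlap, harmlessly; with k_i = floor (x_i /
   r), the coordinates of x - grid k lie in [0, r). *)
pose grid (k : 'rV[int]_d) : 'rV[R]_d := \row_i (r * (k ord0 i)%:~R).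
pose F n : set 'rV[R]_d := if unpickle n is Some k then
  Om `&` shiftset (cube r) (- grid k) else set0.
apply: (@le_trans _ _ (mu (\bigcup_n F n))).
  apply: le_outer_measure => x Omx.
  pose k : 'rV[int]_d := \row_i Num.floor (x ord0 i / r).
  exists (pickle k) => //; rewrite /F pickleK; split => //.
  apply/cubeP => i; rewrite !mxE.
  have := Num.Theory.floor_itv (x ord0 i / r).
  rewrite intrD ler_pdivlMr// ltr_pdivrMr// => /andP[h1 h2].
  by apply/andP; split; lra.
apply: le_trans (outer_measure_sigma_subadditive _ _) _.
rewrite eseries0// => n _ _; rewrite /F; case: (unpickle n) => [k|].
  apply/eqP; rewrite eq_le outer_measure_ge0 andbT.
  by rewrite leNgt; apply/negP; exact: h.
exact: outer_measure0.
Qed.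

Lemma ge0_integral_comb (f g : LebRd R d -> R) (k : R) :
  measurable_fun setT (EFin \o f) -> measurable_fun setT (EFin \o g) ->
  (forall x, 0 <= f x) -> (forall x, 0 <= g x) -> 0 <= k ->
  (\int[mu]_x (f x + k * g x)%:E =
   \int[mu]_x (f x)%:E + k%:E * \int[mu]_x (g x)%:E)%E.
Proof.
move=> mf mg f0 g0 k0.
have g0' x : [set: LebRd R d] x -> (0 <= (g x)%:E)%E by rewrite lee_fin.
have k0' : (0 <= k%:E)%E by rewrite lee_fin.
rewrite -(ge0_integralZl mu measurableT mg g0' k0').
transitivity (\int[mu]_x ((f x)%:E + k%:E * (g x)%:E))%E.
  by apply: eq_integral => x _; rewrite EFinD EFinM.
apply: ge0_integralD.
- exact: measurableT.
- by move=> x _; rewrite lee_fin.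
- exact: mf.
- by move=> x _; rewrite -EFinM lee_fin mulr_ge0.
- apply: emeasurable_funM; [exact: measurable_cst|exact: mg].
Qed.

Lemma measurable_comb (f g : LebRd R d -> R) (k : R) :
  measurable_fun setT (EFin \o f) -> measurable_fun setT (EFin \o g) ->
  measurable_fun setT (EFin \o (fun x : LebRd R d => f x + k * g x)).
Proof.
move=> /measurable_EFinP mf /measurable_EFinP mg; apply/measurable_EFinP.
apply: measurable_funD; first exact: mf.
by apply: measurable_funM; [exact: measurable_cst|exact: mg].
Qed.

End Compactness.

(** * Concentrated weights *)

(** Here [a] and [b] are the masses on the small piece and on the cube. The terms kappa M m cancel
    and three errors take at most s M / 4 each, so s M <= 3 s M / 4. *)
Lemma weight_inequalities (R : realFieldType) (M s m e a b eta kappa : R) :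
  M * s + kappa * (m - e) * a <= eta * b + e * a + kappa * (M * m) ->
  eta * b <= s / 4 * M -> e * a <= s / 4 * M ->
  kappa * (m - e) * ((1 - e) * M) <= kappa * (m - e) * a ->
  kappa * ((1 + m) * e) * M <= s / 4 * M -> 0 <= kappa * (e * e) * M ->
  0 < s * M -> False.
Proof.
have -> : kappa * (m - e) * ((1 - e) * M) = kappa * (M * m) -
  kappa * ((1 + m) * e) * M + kappa * (e * e) * M by ring.
lra.
Qed.

Section Contradiction.
Context (R : realType) (d : nat).
Implicit Types (x y z : 'rV[R]_d) (A B X S : set (LebRd R d)).
Local Notation BorelRd := (g_sigma_algebraType (@boxes R d)).
Local Notation mu := (@lebRd R d).

Variables (Om E : set (LebRd R d)).
Hypotheses (mOm : measurable Om) (bE : measurable (E : set BorelRd))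
  (OmE : Om `<=` E) (EOm0 : mu (E `\` Om) = 0%E).

Let mE : measurable E := borel_measurable bE.

Lemma hull_measure : mu E = mu Om.
Proof.
apply/eqP; rewrite eq_le; apply/andP; split; last exact: le_outer_measure.
rewrite -(setDUK OmE); apply: le_trans (outer_measureU2 _ _ _) _.
by rewrite [X in (_ + X <= _)%E]EOm0 adde0.
Qed.

Lemma hull_overlap X x :
  (mu (X `&` shiftset E x) <= mu (X `&` shiftset Om x))%E.
Proof.
apply: (@le_trans _ _ (mu ((X `&` shiftset Om x) `|` shiftset (E `\` Om) x))).
  apply: le_outer_measure => y [Xy Ey].
  by have [Oy|nOy] := pselect (Om (y + x)); [left|right].
apply: le_trans (outer_measureU2 _ _ _) _.
have := lebesgue_outer_shift_le (E `\` Om) x; rewrite [X in (_ <= X)%E]EOm0.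
by move=> h; rewrite -[leRHS]adde0; apply: leeD.
Qed.

Lemma integral_hull_shift (rho : LebRd R d -> R) (M : R) y :
  measurable_fun setT rho -> (forall x, 0 <= rho x) ->
  (forall z, \int[mu]_(x in Om) (rho (x + z))%:E = M%:E)%E ->
  (\int[mu]_x (rho x * \1_E (x + y)%R)%:E = M%:E)%E.
Proof.
move=> mrho rho0 rhoM.
pose f : LebRd R d -> \bar R := fun w => (rho (w - y)%R * \1_E w)%:E.
have mtr z : measurable_fun [set: LebRd R d]
    (fun x : LebRd R d => (x + z : LebRd R d)).
  by move=> _ A mA; rewrite setTI; exact: measurable_shift.
have mrz z : measurable_fun [set: LebRd R d] (fun x : LebRd R d => rho (x + z)).
  exact: (measurableT_comp mrho (mtr z)).
have mf : measurable_fun setT f.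
  by apply/measurable_EFinP; apply: measurable_funM;
    [exact: mrz|exact: measurable_indic].
have f0 x : (0 <= f x)%E by rewrite lee_fin mulr_ge0.
have := integral_shift y mf f0; rewrite {1}/f.
under eq_integral do rewrite addrK.
move=> ->; rewrite -(rhoM (- y)).
transitivity (\int[mu]_(x in E) (rho (x - y))%:E)%E.
  rewrite [RHS]integral_mkcond; apply: eq_integral => x _.
  by rewrite /f patchE indicE; case: (_ \in _); rewrite ?mulr1 ?mulr0.
have mN : measurable (E `\` Om) by exact: measurableD.
have mr' : measurable_fun E (fun x : LebRd R d => (rho (x - y))%:E).
  by apply/measurable_EFinP; apply: measurable_funTS; exact: mrz.
have r0 x : E x -> (0 <= (rho (x - y))%:E)%E by rewrite lee_fin.
by rewrite (ge0_negligible_integral mN mE mr' r0 EOm0) setDD setIidr.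
Qed.

Variables (S : set (LebRd R d)) (K : R).
Hypotheses (mS : measurable S) (Om0 : (0 < mu Om)%E) (S0 : (0 < mu S)%E)
  (EK : E `<=` cube K) (SK : S `<=` cube K) (SOm : mu (S `&` Om) = 0%E)
  (SOmpos : forall x, (0 < mu (S `&` shiftset Om x))%E ->
     (0 < mu (Om `&` shiftset Om x))%E).

Let Efin : (mu E < +oo)%E.
Proof. by apply: le_lt_trans (le_outer_measure _ _ _ EK) _; exact: lebesgue_outer_cube. Qed.

Let Omfin : (mu Om < +oo)%E. Proof. by rewrite -hull_measure. Qed.

Let Sfin : (mu S < +oo)%E.
Proof. by apply: le_lt_trans (le_outer_measure _ _ _ SK) _; exact: lebesgue_outer_cube. Qed.

Let fine_measure X : (mu X < +oo)%E -> (fine (mu X))%:E = mu X.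
Proof. by move=> Xfin; rewrite fineK// ge0_fin_numE//; exact: outer_measure_ge0. Qed.

Lemma overlap_pos x : 0 < overlap S E x -> 0 < overlap Om E x.
Proof.
rewrite -!lte_fin !EFin_overlap// => h.
apply: (@lt_le_trans _ _ (mu (Om `&` shiftset Om x))).
  by apply: SOmpos; apply: lt_le_trans h (hull_overlap S x).
by apply: le_outer_measure => y [Oy Oxy]; split => //; exact: OmE.
Qed.

Lemma overlap_cube x : ~ cube (2 * K) x -> overlap S E x = 0.
Proof.
move=> nx; rewrite /overlap (_ : _ `&` _ = set0).
  by rewrite [mu set0]outer_measure0.
apply/seteqP; split => // y [Sy Ey]; apply: nx; apply/cubeP => i.
have /cubeP/(_ i)/andP[h1 h2] := SK Sy.
have /cubeP/(_ i) := EK Ey; rewrite mxE => /andP[h3 h4].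
by apply/andP; split; lra.
Qed.

Lemma overlap_cube3 x : cube (2 * K) x ->
  overlap (cube (3 * K)) E x = fine (mu Om).
Proof.
move=> /cubeP xK; rewrite /overlap setIidr; last first.
  move=> y Ey; apply/cubeP => i; have /andP[h1 h2] := xK i.
  have /cubeP/(_ i) := EK Ey; rewrite mxE => /andP[h3 h4].
  by apply/andP; split; lra.
by rewrite -hull_measure; congr fine; exact: lebesgue_outer_shift.
Qed.

Section Weight.
Variables (rho : LebRd R d -> R) (M : R).
Hypotheses (mrho : measurable_fun setT rho) (rho0 : forall x, 0 <= rho x)
  (rhoM : forall z, (\int[mu]_(x in Om) (rho (x + z))%:E = M%:E)%E).

Lemma integral_overlap X : measurable X -> (mu X < +oo)%E ->
  (\int[mu]_x (rho x * overlap X E x)%:E = (M * fine (mu X))%:E)%E.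
Proof.
move=> mX Xfin; rewrite (tonelli_overlap mX bE mrho rho0 Xfin).
under eq_integral do rewrite (integral_hull_shift _ mrho rho0 rhoM).
by rewrite integral_cst// EFinM fine_measure.
Qed.

Let mind X : measurable X ->
  measurable_fun setT (EFin \o (fun x : LebRd R d => rho x * \1_X x)).
Proof.
move=> mX; apply/measurable_EFinP; apply: measurable_funM; first exact: mrho.
exact: measurable_indic.
Qed.

Let ind0 X x : 0 <= rho x * \1_X x. Proof. by rewrite mulr_ge0. Qed.

Let mzero : measurable_fun setT (EFin \o (fun=> 0 : R) : LebRd R d -> \bar R).
Proof. by apply/measurable_EFinP; exact: measurable_cst. Qed.

(** Bounds the mass near the origin by a multiple of [M] that does not depend on [rho]: m(Omega)
    times the indicator is at most the overlap with the larger cube, whose integral is known. *)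
Lemma integral_cube_le :
  ((fine (mu Om))%:E * \int[mu]_x (rho x * \1_(cube (2 * K)) x)%:E <=
   (M * fine (mu (cube (3 * K))))%:E)%E.
Proof.
have mQ := @measurable_box R d (const_mx (- (2 * K))) (const_mx (2 * K)).
have mB := @measurable_box R d (const_mx (- (3 * K))) (const_mx (3 * K)).
have Bfin := @lebesgue_outer_cube R d (3 * K).
have m0 : 0 <= fine (mu Om) by rewrite fine_ge0//; exact: outer_measure_ge0.
rewrite -(integral_overlap mB Bfin).
rewrite -[leLHS]add0e -[X in (X + _)%E](integral0 mu setT).
rewrite -(ge0_integral_comb mzero (mind mQ) (fun=> lexx 0) (ind0 _) m0).
apply: ge0_le_integral.
- exact: measurableT.
- by move=> x _; rewrite lee_fin add0r mulr_ge0.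
- exact: (measurable_comb _ mzero (mind mQ)).
- exact: (measurable_rho_overlap mB bE mrho rho0 Bfin).
- move=> x _; rewrite lee_fin add0r mulrCA ler_wpM2l// indicE.
  have [xQ|xQ] := boolP (x \in _).
    by rewrite mulr1 overlap_cube3//; exact: set_mem.
  by rewrite mulr0; exact: overlap_ge0.
Qed.

(* On [A] the density is close to a point mass at the origin, where the overlap
   with [Om] is nearly full and the overlap with [S] nearly vanishes; off [A]
   the mass seen by [Om] is negligible. *)
Lemma integral_overlap_split (A : set (LebRd R d)) (e eta kappa : R) :
  measurable A -> 0 <= e <= fine (mu Om) -> 0 <= eta -> 0 <= kappa ->
  (forall x, A x -> fine (mu Om) - e <= overlap Om E x /\ overlap S E x <= e) ->
  (forall x, cube (2 * K) x -> overlap S E x <= eta + kappa * overlap Om E x) ->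
  ((M * fine (mu S))%:E +
     (kappa * (fine (mu Om) - e))%:E * \int[mu]_x (rho x * \1_A x)%:E <=
   eta%:E * \int[mu]_x (rho x * \1_(cube (2 * K)) x)%:E +
   e%:E * \int[mu]_x (rho x * \1_A x)%:E +
   (kappa * (M * fine (mu Om)))%:E)%E.
Proof.
move=> mA /andP[e0 eOm] eta0 kappa0 hA hQ.
have mQ := @measurable_box R d (const_mx (- (2 * K))) (const_mx (2 * K)).
have ke0 : 0 <= kappa * (fine (mu Om) - e) by rewrite mulr_ge0// subr_ge0.
have ov0 X x : 0 <= rho x * overlap X E x by rewrite mulr_ge0 ?overlap_ge0.
have mS' := measurable_rho_overlap mS bE mrho rho0 Sfin.
have mO' := measurable_rho_overlap mOm bE mrho rho0 Omfin.
have c0 (f g : LebRd R d -> R) (k : R) :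
    (forall x, 0 <= f x) -> (forall x, 0 <= g x) -> 0 <= k ->
    forall x, 0 <= f x + k * g x.
  by move=> f0 g0 k0 x; rewrite addr_ge0// mulr_ge0.
have z0 (x : LebRd R d) : 0 <= (fun=> 0 : R) x by [].
have mc1 := measurable_comb eta mzero (mind mQ).
have mc2 := measurable_comb e mc1 (mind mA).
have i1 := c0 _ _ _ z0 (ind0 (cube (2 * K))) eta0.
have i2 := c0 _ _ _ i1 (ind0 A) e0.
rewrite (EFinM kappa (M * fine (mu Om))) -(integral_overlap mOm Omfin) -(integral_overlap mS Sfin).
rewrite -(ge0_integral_comb mS' (mind mA) (ov0 S) (ind0 A) ke0).
rewrite -[X in (_ <= X + _ + _)%E]add0e.
rewrite -[X in (_ <= X + _ + _ + _)%E](integral0 mu setT).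
rewrite -(ge0_integral_comb mzero (mind mQ) z0 (ind0 _) eta0).
rewrite -(ge0_integral_comb mc1 (mind mA) i1 (ind0 _) e0).
rewrite -(ge0_integral_comb mc2 mO' i2 (ov0 Om) kappa0).
(* Both sides avoid subtraction, since finiteness of the integrals is not yet known. The inequality
   is pointwise: on [A] by [hA], elsewhere in the cube by [hQ], and outside it because the overlap
   with [S] is 0. *)
apply: ge0_le_integral.
- exact: measurableT.
- by move=> x _; rewrite lee_fin; exact: (c0 _ _ _ (ov0 S) (ind0 A) ke0 x).
- exact: (measurable_comb _ mS' (mind mA)).
- exact: (measurable_comb _ mc2 mO').
move=> x _; rewrite lee_fin add0r.
have -> : eta * (rho x * \1_(cube (2 * K)) x) + e * (rho x * \1_A x) +
    kappa * (rho x * overlap Om E x) =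
  rho x * (eta * \1_(cube (2 * K)) x + e * \1_A x + kappa * overlap Om E x).
  by ring.
have -> : rho x * overlap S E x +
    kappa * (fine (mu Om) - e) * (rho x * \1_A x) =
  rho x * (overlap S E x + kappa * (fine (mu Om) - e) * \1_A x) by ring.
apply: ler_wpM2l => //.
have kO : 0 <= kappa * overlap Om E x by rewrite mulr_ge0// overlap_ge0.
have q0 : 0 <= eta * \1_(cube (2 * K)) x by rewrite mulr_ge0.
have [xA|xA] := boolP (x \in A).
  rewrite [\1_A x]indicE xA !mulr1.
  have [h1 h2] := hA x (set_mem xA).
  apply: lerD; last exact: ler_wpM2l.
  by apply: le_trans h2 _; rewrite lerDr.
rewrite [\1_A x]indicE (negbTE xA) !mulr0 !addr0.
have [xQ|xQ] := pselect (cube (2 * K) x).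
  by rewrite indicE mem_set// mulr1; exact: hQ.
by rewrite overlap_cube// addr_ge0.
Qed.

End Weight.

(** Spectrality enters only through the hypothesis, which is applied after all constants have been
    chosen. *)
Lemma no_concentrated_weight :
  (forall (G : set (LebRd R d)) (e : R),
    measurable G -> G `<=` Om -> (0 < mu G)%E -> 0 < e -> e <= 1 ->
    exists (rho : LebRd R d -> R) (M : R),
    [/\ measurable_fun setT rho, forall x, 0 <= rho x, 0 < M,
        forall z, (\int[mu]_(x in Om) (rho (x + z))%:E = M%:E)%E &
        (((1 - e) * M)%:E <= \int[mu]_(x in G) (rho x)%:E)%E]) -> False.
Proof.
move=> dens.
have Bfin := @lebesgue_outer_cube R d (3 * K).
set m := fine (mu Om); set s := fine (mu S).
have m0 : 0 < m by rewrite -lte_fin fine_measure.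
have s0 : 0 < s by rewrite -lte_fin fine_measure.
(* Chosen so that the mass on the cube is at most C M; the + 1 ensures C > 0. *)
pose C : R := (fine (mu (cube (3 * K))) + 1) / m.
have C0 : 0 < C by rewrite divr_gt0// ltr_pwDr// fine_ge0//; exact: outer_measure_ge0.
(* Gives eta C = s / 4. *)
pose eta : R := s / (4 * C).
have eta0 : 0 < eta by rewrite divr_gt0// mulr_gt0.
have [c c0 hc] := overlap_uniform_pos (2 * K) mE Efin Omfin Sfin overlap_pos eta0.
(* Where the overlap with [S] is at least [eta], kappa times the overlap with Omega is at least
   kappa c = s, the largest value the former can take. *)
pose kappa : R := s / c; have kappa0 : 0 < kappa by rewrite divr_gt0.
pose e1 : R := s / (4 * kappa * (1 + m)).
have m1 : 0 < 1 + m by exact: addr_gt0.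
have k4 : 0 < 4 * kappa * (1 + m) by apply: mulr_gt0 => //; apply: mulr_gt0 => //; rewrite ltr0n.
have e10 : 0 < e1 by exact: divr_gt0.
(* The bounds 1 and [m] are side conditions of [dens] and [integral_overlap_split]; s / 4 and [e1]
   control two of the error terms. *)
pose e : R := minr (minr 1 m) (minr (s / 4) e1).
have e0 : 0 < e by rewrite !lt_min ltr01 m0 e10 andbT /= divr_gt0.
have : e <= e by [].
rewrite {2}/e !le_min => /andP[/andP[e1' em] /andP[es ee1]].
have [t1 t10 ht1] := overlap_near Omfin mE Efin e0.
have [t2 t20 ht2] := overlap_near Sfin mE Efin e0.
pose r : R := minr t1 t2 / 2.
have r0 : 0 < r by rewrite divr_gt0// lt_min t10.
have [rt1 rt2] : r < t1 /\ r < t2.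
  have tm : 0 < minr t1 t2 by rewrite lt_min t10.
  have [h1 h2] : minr t1 t2 <= t1 /\ minr t1 t2 <= t2.
    by rewrite !ge_min !lexx orbT.
  by rewrite /r; split; lra.
(* Translation by [p] brings this piece of Omega within r of the origin. *)
have [p p0] := exists_pos_small_piece r0 Om0.
set G := (X in mu X) in p0.
have mG : measurable G.
  by apply: measurableI => //; apply: measurable_shift; exact: measurable_box.
have [rho [M [mrho rho0 M0 rhoM rhoG]]] := dens G e mG (@subIsetl _ _ _) p0 e0 e1'.
have mtr : measurable_fun [set: LebRd R d]
    (fun x : LebRd R d => (x + p : LebRd R d)).
  by move=> _ A mA; rewrite setTI; exact: measurable_shift.
pose w : LebRd R d -> R := fun x => rho (x + p).
have mw : measurable_fun [set: LebRd R d] w by exact: (measurableT_comp mrho mtr).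
have w0 x : 0 <= w x by exact: rho0.
have wM z : (\int[mu]_(x in Om) (w (x + z))%:E = M%:E)%E.
  by rewrite -(rhoM (z + p)); apply: eq_integral => x _; rewrite /w addrA.
pose A : set (LebRd R d) := shiftset G p.
have mA : measurable A by exact: measurable_shift.
have IA : (\int[mu]_x (w x * \1_A x)%:E = \int[mu]_(x in G) (rho x)%:E)%E.
  pose f : LebRd R d -> \bar R := fun x => (rho x * \1_G x)%:E.
  have mf : measurable_fun setT f.
    by apply/measurable_EFinP; apply: measurable_funM; [exact: mrho|exact: measurable_indic].
  have f0 x : (0 <= f x)%E by rewrite lee_fin mulr_ge0.
  have := integral_shift p mf f0; rewrite /f => h.
  rewrite [RHS]integral_mkcond.
  transitivity (\int[mu]_x (rho x * \1_G x)%:E)%E; first by rewrite -h.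
  apply: eq_integral => x _.
  by rewrite patchE indicE; case: (_ \in _); rewrite ?mulr1 ?mulr0.
have IAM : (\int[mu]_x (w x * \1_A x)%:E <= M%:E)%E.
  have <- : (\int[mu]_(x in Om) (rho x)%:E = M%:E)%E.
    by rewrite -(rhoM 0); apply: eq_integral => x _; rewrite addr0.
  rewrite IA.
  apply: (ge0_subset_integral mu mG mOm _ _ (@subIsetl _ _ _)).
    by apply/measurable_EFinP; apply: measurable_funTS.
  by move=> x _; rewrite lee_fin.
have Amem x : A x -> (forall i, `|(x - 0) ord0 i| < t1) /\
    (forall i, `|(x - 0) ord0 i| < t2).
  move=> [_ /cubeP xr]; rewrite subr0; split=> i; have := xr i;
    rewrite addrK => /andP[h1 h2]; rewrite ltr_norml; apply/andP; split; lra.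
(* At the origin the two overlaps are exactly [m] and 0, and on [A] each has moved by at most
   [e]. *)
have hA x : A x -> m - e <= overlap Om E x /\ overlap S E x <= e.
  move=> /Amem[h1 h2]; split.
    have := ht1 _ _ h1; rewrite {1}/overlap shiftset0 setIidl// -/m; lra.
  have h2' i : `|(0 - x) ord0 i| < t2.
    by have := h2 i; rewrite !mxE subr0 sub0r normrN.
  have := ht2 _ _ h2'; suff -> : overlap S E 0 = 0 by rewrite add0r.
  rewrite /overlap; have := hull_overlap S 0; rewrite !shiftset0 [leRHS]SOm => h.
  suff -> : mu (S `&` E) = 0%E by [].
  by apply/eqP; rewrite eq_le h; exact: outer_measure_ge0.
have hQ x : cube (2 * K) x -> overlap S E x <= eta + kappa * overlap Om E x.
  move=> /cubeP xQ.
  have xK i : `|x ord0 i| <= 2 * K.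
    by have /andP[h1 h2] := xQ i; rewrite ler_norml h1 ltW.
  have [h|h] := leP eta (overlap S E x).
    have hk : s <= kappa * overlap Om E x.
      have -> : s = kappa * c by rewrite /kappa divfK// gt_eqF.
      by apply: ler_wpM2l; [exact: ltW|exact: hc].
    have := overlap_le E x Sfin; rewrite -/s; lra.
  have : 0 <= kappa * overlap Om E x by rewrite mulr_ge0 ?overlap_ge0// ltW.
  lra.
have e0m : 0 <= e <= m by rewrite (ltW e0) em.
have := integral_overlap_split mw w0 wM mA e0m (ltW eta0) (ltW kappa0) hA hQ.
have := integral_cube_le mw w0 wM.
rewrite -IA in rhoG.
have a0 : (0 <= \int[mu]_x (w x * \1_A x)%:E)%E.
  by apply: integral_ge0 => x _; rewrite lee_fin mulr_ge0.
have b0 : (0 <= \int[mu]_x (w x * \1_(cube (2 * K)) x)%:E)%E.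
  by apply: integral_ge0 => x _; rewrite lee_fin mulr_ge0.
move: (\int[mu]_x (w x * \1_A x)%:E)%E a0 IAM rhoG {IA} => [a||]//.
rewrite !lee_fin => a0 aM Ma.
(* An infinite mass on the cube would contradict [integral_cube_le]. *)
move: (\int[mu]_x (w x * \1_(cube (2 * K)) x)%:E)%E b0 => [b||]//; last first.
  by rewrite gt0_muley ?lte_fin// leye_eq.
rewrite -/m -/s -!EFinM -!EFinD !lee_fin => b0 mb main.
have bC : b <= C * M.
  rewrite /C mulrAC ler_pdivlMr// mulrC; apply: le_trans mb _.
  by rewrite mulrC ler_wpM2r ?(ltW M0)// lerDl.
have etaC : eta * b <= s / 4 * M.
  have -> : s / 4 = eta * C by rewrite /eta; field; rewrite gt_eqF.
  by rewrite -mulrA ler_wpM2l// ltW.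
have ke : kappa * ((1 + m) * e) <= s / 4.
  have h : e * (4 * kappa * (1 + m)) <= s.
    by rewrite -ler_pdivlMr.
  by have -> : kappa * ((1 + m) * e) = e * (4 * kappa * (1 + m)) / 4;
    [field|lra].
have ea : e * a <= s / 4 * M by apply: ler_pM; [exact: ltW|exact: a0|exact: es|exact: aM].
have ka : kappa * (m - e) * ((1 - e) * M) <= kappa * (m - e) * a.
  by rewrite ler_wpM2l// mulr_ge0 ?subr_ge0// ltW.
have kM : kappa * ((1 + m) * e) * M <= s / 4 * M.
  by rewrite ler_wpM2r// ltW.
have kk : 0 <= kappa * (e * e) * M.
  by rewrite ltW//; do ![apply: mulr_gt0 => //].
have sM : 0 < s * M by rewrite mulr_gt0.
exact: (weight_inequalities main etaC ea ka kM kk sM).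
Qed.

End Contradiction.

Theorem theorem3p2 (R : realType) (d : nat) (Omega : set (LebRd R d)) :
  measurable Omega -> bounded_Rd Omega -> (0 < lebRd Omega)%E ->
  (exists S : set (LebRd R d),
     [/\ measurable S,
         (0 < lebRd S)%E,
         lebRd (S `&` Omega) = 0%E &
         forall x : 'rV[R]_d,
           (0 < lebRd (translate Omega x `&` S))%E ->
           (0 < lebRd (translate Omega x `&` Omega))%E]) ->
  ~ spectral Omega.
Proof.
move=> mOm [K1 OmK] Om0 [S [mS S0 SOm hS]] [L [_ [orthL totL]]].
(* [S] is cut down to a bounded piece, so that its overlaps are finite and vanish outside a cube;
   (ii) and (iii) pass to subsets. *)
have [n Sn0] := exists_pos_cube S0.
pose S' := S `&` cube n.+1%:R.
have mS' : measurable S' by apply: measurableI => //; exact: measurable_box.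
(* The + 1 is there because the cubes lack their upper faces. *)
have OmK1 : Omega `<=` cube (K1 + 1).
  move=> x /OmK xK; apply/cubeP => i; have := xK i; rewrite ler_norml.
  by move=> /andP[h1 h2]; apply/andP; split; lra.
have [E [bE OmE EK EOm0]] := borel_hull mOm OmK1.
pose K := maxr (K1 + 1) n.+1%:R.
have Omfin : (lebRd Omega < +oo)%E.
  apply: le_lt_trans (le_outer_measure (@lebesgue_outer R d) _ _ OmK1) _.
  exact: lebesgue_outer_cube.
apply: (@no_concentrated_weight R d Omega E mOm bE OmE EOm0 S' K) => //.
- by move=> x /EK; apply: cube_subset; rewrite le_max lexx.
- by move=> x [_]; apply: cube_subset; rewrite le_max lexx orbT.
- apply/eqP; rewrite eq_le outer_measure_ge0 andbT -SOm.
  by apply: le_outer_measure => x [[]].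
- move=> x h; have := hS (- x).
  rewrite translateE opprK setIC [X in _ -> (0 < lebRd X)%E]setIC; apply.
  by apply: lt_le_trans h _; apply: le_outer_measure => y [[]].
- move=> G e mG GOm G0 e0 e1.
  exact: (@concentrated_density R d Omega L mOm Omfin orthL totL).
Qed.
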